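(* Let $F$ be a number field and let $\mathcal{P}_F$ be the Bost-Connes pair for $F$. The finite symmetry semigroup $\mathrm{Sym}_f$ of $\mathcal{P}_F$ is $\widehat{\mathcal{O}}_F^\natural:=\widehat{\mathcal{O}}_F\cap\mathbb{A}_{f,F}^\times$, and its zeta function $\zeta_{\mathcal{P}_F}$ is the Dedekind zeta function $\zeta_F$ of $F$.
   Context: $\mathbb{A}_{f,F}$ is the ring of finite adeles of $F$, and $\widehat{\mathcal{O}}_F=\mathcal{O}_F\otimes_{\mathbb{Z}}\widehat{\mathbb{Z}}\subset\mathbb{A}_{f,F}$. The Bost-Connes pair $\mathcal{P}_F$ consists of the algebraic data $G=\mathrm{Res}_{F/\mathbb{Q}}\mathbb{G}_{m,F}$, $X_F=G(\mathbb{R})/G(\mathbb{R})^+$ (where $G(\mathbb R)^+$ is the identity component), $V=F$ as a $\mathbb{Q}$-vector space with the representation $\phi:G\to \mathrm{GL}(V)$ given by multiplication, and the multiplicative semigroup $M=\mathrm{Res}_{F/\mathbb{Q}}\mathrm{M}_{1,F}$ (whose unit group is $G$), together with the level structure given by the lattice $L=\mathcal{O}_F\subset V$, the compact open subgroup $K=\widehat{\mathcal{O}}_F^\times\subset G(\mathbb{A}_f)=\mathbb{A}_{f,F}^\times$ and the compact open subsemigroup $K_M=\widehat{\mathcal{O}}_F\subset M(\mathbb{A}_f)=\mathbb{A}_{f,F}$. The finite symmetry semigroup is $\mathrm{Sym}_f:=\phi^{-1}(K_M)=\{g\in G(\mathbb{A}_f): \phi(g)\in K_M\}$, and $\mathrm{Sym}_f^\times$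 is its group of invertible elements. For $g\in G(\mathbb{A}_f)$, $\det(\phi(g))$ denotes the unique positive rational $q$ such that the determinant of $\phi(g)$ acting on $V\otimes_{\mathbb Q}\mathbb{A}_f$ lies in $q\,\widehat{\mathbb{Z}}^\times$. The zeta function of the pair is the series $$\zeta_{\mathcal{P}_F}(\beta):=\sum_{g\in \mathrm{Sym}_f^\times\backslash\mathrm{Sym}_f}\det(\phi(g))^{-\beta}.$$ *)

(* Defs.v *)
From HB Require Import structures.
From mathcomp Require Import all_boot all_order all_algebra all_field.
From mathcomp Require Import fraction mxpoly cyclic finmap.
From mathcomp Require Import all_classical all_reals all_analysis.
From mathcomp Require Import summability complex.

Set Implicit Arguments.
Unset Strict Implicit.
Unset Printing Implicit Defensive.

Import Order.TTheory GRing.Theory Num.Theory.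
Import numFieldNormedType.Exports.

Local Open Scope classical_set_scope.
Local Open Scope ring_scope.

Section ClassicalUnits.
Variable R : comNzRingType.

Definition classical_unit : pred R := fun x => `[< exists y : R, y * x = 1 >].

Definition classical_inv (x : R) : R :=
  if pselect (exists y : R, y * x = 1) is left e then projT1 (cid e) else x.

Lemma classical_mulVr :
  {in classical_unit, left_inverse 1 classical_inv *%R}.
Proof.
move=> x /asboolP ux; rewrite /classical_inv.
by case: pselect => // e; exact: (projT2 (cid e)).
Qed.

Lemma classical_unitPl (x y : R) : y * x = 1 -> classical_unit x.
Proof. by move=> yx1; apply/asboolP; exists y. Qed.

Lemma classical_inv_out : {in [predC classical_unit], classical_inv =1 id}.
Proof.
move=> x /asboolP nux; rewrite /classical_inv; by case: pselect.
Qed.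

End ClassicalUnits.

Definition prime_nat : Type := {p : nat | prime p}.
HB.instance Definition _ := Choice.on prime_nat.

(* Z_p is the inverse limit of the Z/p^n: the n-th entry of the sequence is   *)
(* the canonical representative of the residue class modulo p^n.              *)
Section PadicIntegers.
Variable p : prime_nat.
Local Notation q := (val p).

Record padic_int := PadicInt {
  padic_seq :> nat -> nat;
  _ : `[< forall n, padic_seq n = (padic_seq n.+1 %% q ^ n)%N >] }.

HB.instance Definition _ := [isSub for padic_seq].
HB.instance Definition _ := [Choice of padic_int by <:].

Lemma padic_pr : prime q. Proof. exact: (valP p). Qed.

Lemma padic_expn_gt0 n : (0 < q ^ n)%N.
Proof. by rewrite expn_gt0 prime_gt0 // padic_pr. Qed.

Lemma padicE (a : padic_int) n : (a n.+1 %% q ^ n)%N = a n.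
Proof. by case: a => a /= /asboolP/(_ n). Qed.

Lemma padic_mod (a : padic_int) n : (a n %% q ^ n)%N = a n.
Proof. by rewrite -padicE modn_mod. Qed.

Lemma padicP (a b : padic_int) : a =1 b -> a = b.
Proof. by move=> ab; apply: val_inj; apply/funext. Qed.

Lemma padic_mk_subproof (f : nat -> nat) :
  (forall n, f n.+1 = f n %[mod q ^ n]) ->
  `[< forall n, (f n %% q ^ n = (f n.+1 %% q ^ n.+1) %% q ^ n)%N >].
Proof. by move=> fP; apply/asboolP => n; rewrite modn_dvdm ?dvdn_exp2l // fP. Qed.

Definition padic_mk f fP : padic_int := PadicInt (@padic_mk_subproof f fP).

Lemma padic_const_subproof (c n : nat) : c = c %[mod q ^ n].
Proof. by []. Qed.

Lemma padic_add_subproof (a b : padic_int) n :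
  (a n.+1 + b n.+1 = a n + b n %[mod q ^ n])%N.
Proof. by rewrite -(padicE a n) -(padicE b n) modnDm. Qed.

Lemma padic_mul_subproof (a b : padic_int) n :
  (a n.+1 * b n.+1 = a n * b n %[mod q ^ n])%N.
Proof. by rewrite -(padicE a n) -(padicE b n) modnMm. Qed.

Lemma padic_opp_subproof (a : padic_int) n :
  (q ^ n.+1 - a n.+1 = q ^ n - a n %[mod q ^ n])%N.
Proof.
have le m : (a m <= q ^ m)%N by rewrite -padic_mod ltnW // ltn_mod padic_expn_gt0.
apply/eqP; rewrite -(eqn_modDr (a n.+1)) subnK //.
rewrite -(modnDmr (q ^ n - a n)) padicE subnK // modnn.
by rewrite expnS modnMl.
Qed.

Definition padic_zero := padic_mk (padic_const_subproof 0).
Definition padic_one := padic_mk (padic_const_subproof 1).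
Definition padic_add a b := padic_mk (padic_add_subproof a b).
Definition padic_mul a b := padic_mk (padic_mul_subproof a b).
Definition padic_opp a := padic_mk (padic_opp_subproof a).

Lemma padic_addA : associative padic_add.
Proof. by move=> a b c; apply: padicP => n /=; rewrite modnDml modnDmr addnA. Qed.
Lemma padic_addC : commutative padic_add.
Proof. by move=> a b; apply: padicP => n /=; rewrite addnC. Qed.
Lemma padic_add0 : left_id padic_zero padic_add.
Proof. by move=> a; apply: padicP => n /=; rewrite mod0n add0n padic_mod. Qed.
Lemma padic_addN : left_inverse padic_zero padic_opp padic_add.
Proof.
move=> a; apply: padicP => n /=; rewrite modnDml subnK ?modnn ?mod0n //.
by rewrite -padic_mod ltnW // ltn_mod padic_expn_gt0.
Qed.

HB.instance Definition _ := GRing.isZmodule.Build padic_int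
  padic_addA padic_addC padic_add0 padic_addN.

Lemma padic_mulA : associative padic_mul.
Proof. by move=> a b c; apply: padicP => n /=; rewrite modnMml modnMmr mulnA. Qed.
Lemma padic_mulC : commutative padic_mul.
Proof. by move=> a b; apply: padicP => n /=; rewrite mulnC. Qed.
Lemma padic_mul1 : left_id padic_one padic_mul.
Proof. by move=> a; apply: padicP => n /=; rewrite modnMml mul1n padic_mod. Qed.
Lemma padic_mulDl : left_distributive padic_mul +%R.
Proof.
by move=> a b c; apply: padicP => n /=; rewrite modnMml modnDml modnDmr mulnDl.
Qed.
Lemma padic_oner_neq0 : padic_one != 0.
Proof.
apply/eqP => /(congr1 (fun a : padic_int => a 1)) /=.
by rewrite mod0n modn_small // expn1 prime_gt1 // padic_pr.
Qed.

HB.instance Definition _ := GRing.Zmodule_isComNzRing.Build padic_int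
  padic_mulA padic_mulC padic_mul1 padic_mulDl padic_oner_neq0.
HB.instance Definition _ := GRing.ComNzRing_hasMulInverse.Build padic_int
  (@classical_mulVr padic_int) (@classical_unitPl padic_int)
  (@classical_inv_out padic_int).

Lemma padic_seqD (a b : padic_int) n : (a + b) n = ((a n + b n) %% q ^ n)%N.
Proof. by []. Qed.
Lemma padic_seqM (a b : padic_int) n : (a * b) n = ((a n * b n) %% q ^ n)%N.
Proof. by []. Qed.
Lemma padic_seq0 n : (0 : padic_int) n = 0%N.
Proof. exact: mod0n. Qed.
Lemma padic_seq_nat k n : (k%:R : padic_int) n = (k %% q ^ n)%N.
Proof.
elim: k => [|k IHk] //.
by rewrite mulrS padic_seqD IHk -[in RHS]add1n -[in RHS]modnDm.
Qed.

Lemma padic_mod_le (a : padic_int) m n : (m <= n)%N -> (a n %% q ^ m)%N = a m.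
Proof.
move=> /subnK <-; elim: (n - m)%N => [|k IHk]; first exact: padic_mod.
rewrite addSn -[RHS]IHk -[in RHS]padicE modn_dvdm //.
by rewrite dvdn_exp2l // leq_addl.
Qed.

Lemma padic_mulf_eq0 (a b : padic_int) : a * b = 0 -> (a == 0) || (b == 0).
Proof.
move=> ab0; case: eqVneq => //= /eqP an0; case: eqVneq => //= /eqP bn0.
have nz (c : padic_int) : c <> 0 -> exists n, c n != 0%N.
  move=> cn0; apply: contrapT => /forallNP c0; apply: cn0; apply: padicP => n.
  by rewrite padic_seq0; apply/eqP/negPn/negP/c0.
have [[i ai] [j bj]] := (nz _ an0, nz _ bn0).
have ndvd (c : padic_int) k : c k != 0%N -> ~~ (q ^ k %| c (i + j + k))%N.
  by apply: contra => /eqP; rewrite padic_mod_le ?leq_addl // => ->.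
have ndvd' (c : padic_int) k : (k <= i + j)%N -> c k != 0%N ->
    ~~ (q ^ k %| c (i + j))%N.
  by move=> ki; apply: contra => /eqP; rewrite padic_mod_le // => ->.
have {ai}ai := ndvd' a i (leq_addr _ _) ai.
have {bj}bj := ndvd' b j (leq_addl _ _) bj.
have a0 : (0 < a (i + j))%N by rewrite lt0n; apply: contra ai => /eqP ->; rewrite dvdn0.
have b0 : (0 < b (i + j))%N by rewrite lt0n; apply: contra bj => /eqP ->; rewrite dvdn0.
have /eqP : (a * b) (i + j)%N = 0%N by rewrite ab0 padic_seq0.
rewrite padic_seqM -/(dvdn _ _) pfactor_dvdn ?padic_pr ?muln_gt0 ?a0 // lognM //.
rewrite pfactor_dvdn ?padic_pr // -ltnNge in ai.
rewrite pfactor_dvdn ?padic_pr // -ltnNge in bj.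
by rewrite leqNgt (leq_ltn_trans _ (leq_add ai (ltnW bj))) // -addnS leq_add.
Qed.

HB.instance Definition _ :=
  GRing.ComUnitRing_isIntegral.Build padic_int padic_mulf_eq0.

Lemma padic_natr_eq0 k : (k%:R == 0 :> padic_int) = (k == 0%N).
Proof.
apply/eqP/eqP => [|-> //] /(congr1 (fun a : padic_int => a k)).
by rewrite padic_seq_nat padic_seq0 modn_small // ltn_expl // prime_gt1 // padic_pr.
Qed.

Lemma padic_intr_eq0 (z : int) : (z%:~R == 0 :> padic_int) = (z == 0).
Proof.
case: z => k; first exact: padic_natr_eq0.
by rewrite NegzE rmorphN oppr_eq0 /= padic_natr_eq0.
Qed.

Lemma padic_unit_coprime (d : nat) : coprime q d ->
  (d%:R : padic_int) \is a GRing.unit.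
Proof.
move=> qd; pose v n := (d ^ (totient (q ^ n)).-1)%N.
have vP n : (d * v n = 1 %[mod q ^ n])%N.
  rewrite /v -expnS prednK ?totient_gt0 ?padic_expn_gt0 //.
  by rewrite Euler_exp_totient // coprimeXr // coprime_sym.
have vS n : (v n.+1 = v n %[mod q ^ n])%N.
  have vS1 : (d * v n.+1 = 1 %[mod q ^ n])%N.
    by rewrite -(@modn_dvdm (q ^ n.+1)) ?vP ?modn_dvdm // dvdn_exp2l.
  rewrite -[in LHS](muln1 (v n.+1)) -modnMmr -vP modnMmr mulnA (mulnC _ d).
  by rewrite -modnMml vS1 modnMml mul1n.
apply/unitrP; exists (padic_mk vS); rewrite mulrC.
suff -> : d%:R * padic_mk vS = 1 by [].
apply: padicP => n; rewrite padic_seqM padic_seq_nat /= modnMml modnMmr.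
exact: vP.
Qed.

End PadicIntegers.

Section RatrCharZero.
Variables (K : fieldType) (charK : forall z : int, (z%:~R == 0 :> K) = (z == 0)).

Lemma ratr_frac (a b : int) : b != 0 ->
  ratr (a%:~R / b%:~R) = a%:~R / b%:~R :> K.
Proof.
move=> b0; rewrite /ratr; set r := a%:~R / b%:~R.
have bQ : b%:~R != 0 :> rat by rewrite intr_eq0.
have e : a * denq r = numq r * b.
  by apply/eqP; rewrite -(eqr_int rat) !intrM numqE mulrAC /r divfK.
apply/eqP; rewrite eqr_div ?charK ?denq_neq0 //.
by rewrite -!intrM e.
Qed.

Lemma ratrD (x y : rat) : ratr (x + y) = ratr x + ratr y :> K.
Proof.
rewrite -{1}(divq_num_den x) -{1}(divq_num_den y) addf_div ?intr_eq0 ?denq_neq0 //.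
rewrite -!intrM -intrD ratr_frac ?mulf_neq0 ?denq_neq0 //.
by rewrite /ratr addf_div ?charK ?denq_neq0 // -!intrM -intrD.
Qed.

Lemma ratrM (x y : rat) : ratr (x * y) = ratr x * ratr y :> K.
Proof.
rewrite -{1}(divq_num_den x) -{1}(divq_num_den y) mulf_div.
rewrite -!intrM ratr_frac ?mulf_neq0 ?denq_neq0 //.
by rewrite /ratr mulf_div -!intrM.
Qed.

Lemma ratr1 : ratr 1 = 1 :> K.
Proof. by rewrite /ratr divr1. Qed.

End RatrCharZero.

Notation padic p := {fraction padic_int p}.

Lemma padic_frac_intr_eq0 p (z : int) : (z%:~R == 0 :> padic p) = (z == 0).
Proof.
rewrite -[z%:~R](rmorph_int (@FracField.tofrac (padic_int p))).
by rewrite tofrac_eq0 padic_intr_eq0.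
Qed.

Definition padic_integral p (x : padic p) :=
  exists a : padic_int p, x = FracField.tofrac a.

Lemma padic_integralD p (x y : padic p) :
  padic_integral x -> padic_integral y -> padic_integral (x + y).
Proof. by move=> [a ->] [b ->]; exists (a + b); rewrite rmorphD. Qed.

Lemma padic_integralM p (x y : padic p) :
  padic_integral x -> padic_integral y -> padic_integral (x * y).
Proof. by move=> [a ->] [b ->]; exists (a * b); rewrite rmorphM. Qed.

Lemma padic_integralN p (x : padic p) : padic_integral x -> padic_integral (- x).
Proof. by move=> [a ->]; exists (- a); rewrite rmorphN. Qed.

Lemma padic_integral_ratr (r : rat) :
  finite_set [set p : prime_nat | ~ padic_integral (ratr r : padic p)].
Proof.
pose s := [seq p <- pmap insub (primes `|denq r|) | true] : seq prime_nat.
apply: (@sub_finite_set _ _ [set` s]); last exact: finite_seq.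
move=> p /= np; rewrite /s filter_predT mem_pmap_sub mem_primes.
rewrite (valP p) absz_gt0 denq_neq0 /=; apply: contrapT => /negP ndvd; apply: np.
have ud : (`|denq r|%:R : padic_int p) \is a GRing.unit.
  by apply: padic_unit_coprime; rewrite prime_coprime ?(valP p).
exists ((numq r)%:~R * (`|denq r|%:R)^-1).
have dz : (`|denq r|%:R : padic_int p) != 0 by rewrite padic_natr_eq0 absz_eq0 denq_neq0.
apply: (mulIf (_ : (denq r)%:~R != 0)); first by rewrite padic_frac_intr_eq0 denq_neq0.
rewrite /ratr divfK ?padic_frac_intr_eq0 ?denq_neq0 //.
rewrite -{2}(gez0_abs (denq_ge0 r)) -pmulrn -(rmorph_nat (@FracField.tofrac (padic_int p))).
by rewrite -rmorphM divrK // rmorph_int.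
Qed.

(* The finite adeles of Q: the restricted product of the Q_p with respect to  *)
(* the Z_p.                                                                   *)
Record adele := Adele {
  adele_fun :> forall p : prime_nat, padic p;
  _ : `[< finite_set [set p | ~ padic_integral (adele_fun p)] >] }.

HB.instance Definition _ := gen_eqMixin adele.
HB.instance Definition _ := gen_choiceMixin adele.

Lemma adele_finite (x : adele) : finite_set [set p | ~ padic_integral (x p)].
Proof. by case: x => x /= /asboolP. Qed.

Lemma adeleP (x y : adele) : (forall p, x p = y p) -> x = y.
Proof.
case: x y => [x xP] [y yP] /= xy.
have {}xy : x = y by apply: functional_extensionality_dep.
by rewrite {}xy in xP *; congr Adele; exact: Prop_irrelevance.
Qed.

Lemma adele_rat_subproof (r : rat) :
  `[< finite_set [set p | ~ padic_integral (ratr r : padic p)] >].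
Proof. exact/asboolP/padic_integral_ratr. Qed.

Lemma adele_add_subproof (x y : adele) :
  `[< finite_set [set p | ~ padic_integral (x p + y p)] >].
Proof.
apply/asboolP; have := conj (adele_finite x) (adele_finite y).
rewrite -finite_setU; apply: sub_finite_set => p /=.
by move=> nxy; apply: contrapT => /not_orP[/contrapT ? /contrapT ?];
  apply: nxy; apply: padic_integralD.
Qed.

Lemma adele_mul_subproof (x y : adele) :
  `[< finite_set [set p | ~ padic_integral (x p * y p)] >].
Proof.
apply/asboolP; have := conj (adele_finite x) (adele_finite y).
rewrite -finite_setU; apply: sub_finite_set => p /=.
by move=> nxy; apply: contrapT => /not_orP[/contrapT ? /contrapT ?];
  apply: nxy; apply: padic_integralM.
Qed.

Lemma adele_opp_subproof (x : adele) :
  `[< finite_set [set p | ~ padic_integral (- x p)] >].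
Proof.
apply/asboolP; apply: sub_finite_set (adele_finite x) => p /= nx xi.
by apply: nx; apply: padic_integralN.
Qed.

Definition adele_rat (r : rat) : adele := Adele (adele_rat_subproof r).
Definition adele_add x y : adele := Adele (adele_add_subproof x y).
Definition adele_mul x y : adele := Adele (adele_mul_subproof x y).
Definition adele_opp x : adele := Adele (adele_opp_subproof x).

Lemma adele_addA : associative adele_add.
Proof. by move=> x y z; apply: adeleP => p /=; rewrite addrA. Qed.
Lemma adele_addC : commutative adele_add.
Proof. by move=> x y; apply: adeleP => p /=; rewrite addrC. Qed.
Lemma adele_add0 : left_id (adele_rat 0) adele_add.
Proof. by move=> x; apply: adeleP => p /=; rewrite /ratr mul0r add0r. Qed.
Lemma adele_addN : left_inverse (adele_rat 0) adele_opp adele_add.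
Proof. by move=> x; apply: adeleP => p /=; rewrite /ratr mul0r addNr. Qed.

HB.instance Definition _ := GRing.isZmodule.Build adele
  adele_addA adele_addC adele_add0 adele_addN.

Lemma adele_mulA : associative adele_mul.
Proof. by move=> x y z; apply: adeleP => p /=; rewrite mulrA. Qed.
Lemma adele_mulC : commutative adele_mul.
Proof. by move=> x y; apply: adeleP => p /=; rewrite mulrC. Qed.
Lemma adele_mul1 : left_id (adele_rat 1) adele_mul.
Proof. by move=> x; apply: adeleP => p /=; rewrite ratr1 mul1r. Qed.
Lemma adele_mulDl : left_distributive adele_mul +%R.
Proof. by move=> x y z; apply: adeleP => p /=; rewrite mulrDl. Qed.
Lemma adele_oner_neq0 : adele_rat 1 != 0.
Proof.
apply/eqP => /(congr1 (fun x : adele => x (exist _ 2%N isT))) /=.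
by rewrite ratr1 /ratr mul0r => /eqP; rewrite oner_eq0.
Qed.

HB.instance Definition _ := GRing.Zmodule_isComNzRing.Build adele
  adele_mulA adele_mulC adele_mul1 adele_mulDl adele_oner_neq0.
HB.instance Definition _ := GRing.ComNzRing_hasMulInverse.Build adele
  (@classical_mulVr adele) (@classical_unitPl adele) (@classical_inv_out adele).

Lemma adele_rat_zmod_morphism : zmod_morphism adele_rat.
Proof.
have D x y : adele_rat (x + y) = adele_rat x + adele_rat y.
  by apply: adeleP => p /=; rewrite ratrD //; exact: padic_frac_intr_eq0.
by move=> x y; apply/eqP; rewrite eq_sym subr_eq -D subrK.
Qed.

Lemma adele_rat_monoid_morphism : monoid_morphism adele_rat.
Proof.
split=> // x y; apply: adeleP => p /=.
by rewrite ratrM //; exact: padic_frac_intr_eq0.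
Qed.

HB.instance Definition _ :=
  GRing.isZmodMorphism.Build rat adele adele_rat adele_rat_zmod_morphism.
HB.instance Definition _ :=
  GRing.isMonoidMorphism.Build rat adele adele_rat adele_rat_monoid_morphism.

(* \hat{Z}, viewed in the finite adeles as the product of the Z_p.            *)
Definition zhat : set adele := [set a | forall p, padic_integral (a p)].

Definition zhat_units : set adele :=
  [set u | zhat u /\ exists2 v, zhat v & u * v = 1].

(* A_{f,F} = F \otimes_Q A_f, in coordinates: the element                     *)
(* \sum_i e_i \otimes g_i, with e the library's Q-basis of F, is the row g.   *)
Definition adeleF (F : fieldExtType rat) : Type := 'rV[adele]_(\dim {:F}).

Section BaseChange.
Variable F : fieldExtType rat.
Local Notation n := (\dim {:F}).
Local Notation e := (vbasis {:F}).
Local Notation AF := (adeleF F).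

HB.instance Definition _ := GRing.Lmodule.on AF.

Definition basis_coord (x : F) : 'rV[rat]_n := \row_j coord e j x.

Definition mult_mx (x : F) : 'M[rat]_n := \matrix_(i, j) coord e j (e`_i * x).

Definition pure_tensor (x : F) (a : adele) : AF :=
  a *: map_mx adele_rat (basis_coord x).

(* The matrix, in the A_f-basis (e_i \otimes 1), of multiplication by g on    *)
(* F \otimes_Q A_f (acting on rows).                                          *)
Definition adele_mult_mx (g : AF) : 'M[adele]_n :=
  \sum_(i < n) g 0 i *: map_mx adele_rat (mult_mx e`_i).

Definition adeleF_mul (g h : AF) : AF := g *m adele_mult_mx h.

Lemma basis_coordE (x : F) : x = \sum_(i < n) basis_coord x 0 i *: e`_i.
Proof.
rewrite [LHS](coord_vbasis (memvf x)); apply: eq_bigr => i _.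
by rewrite mxE.
Qed.

Lemma basis_coord_mul (y x : F) : basis_coord y *m mult_mx x = basis_coord (y * x).
Proof.
apply/rowP => j; rewrite !mxE [in RHS](coord_vbasis (memvf y)) mulr_suml linear_sum.
by apply: eq_bigr => i _; rewrite !mxE -scalerAl linearZ.
Qed.

Lemma adele_mult_mxD (g h : AF) :
  adele_mult_mx (g + h) = adele_mult_mx g + adele_mult_mx h.
Proof. by rewrite -big_split /=; apply: eq_bigr => i _; rewrite mxE scalerDl. Qed.

Lemma adele_mult_mx_pure (x : F) (a : adele) :
  adele_mult_mx (pure_tensor x a) = a *: map_mx adele_rat (mult_mx x).
Proof.
rewrite /adele_mult_mx (eq_bigr (fun i => a *:
  (adele_rat (coord e i x) *: map_mx adele_rat (mult_mx e`_i)))); last first.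
  by move=> i _; rewrite !mxE scalerA.
rewrite -scaler_sumr; congr (_ *: _); apply/matrixP => j k.
rewrite summxE !mxE [in RHS](coord_vbasis (memvf x)) mulr_sumr linear_sum rmorph_sum.
by apply: eq_bigr => i _; rewrite !mxE -scalerAr linearZ rmorphM.
Qed.

Lemma adeleF_mul_pure (x y : F) (a b : adele) :
  adeleF_mul (pure_tensor x a) (pure_tensor y b) = pure_tensor (x * y) (a * b).
Proof.
rewrite /adeleF_mul adele_mult_mx_pure -scalemxAr -scalemxAl -map_mxM.
by rewrite basis_coord_mul scalerA mulrC.
Qed.

Lemma adeleF_decomp (g : AF) : g = \sum_(i < n) pure_tensor e`_i (g 0 i).
Proof.
apply/rowP => j; rewrite summxE (bigD1 j) //= !mxE coord_free ?eqxx; last first.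
  exact: basis_free (vbasisP _).
rewrite rmorph1 mulr1 big1 ?addr0 // => i ij.
rewrite !mxE coord_free ?(basis_free (vbasisP _)) //.
by rewrite (negbTE ij) rmorph0 mulr0.
Qed.

Lemma adeleF_ind (P : AF -> Prop) :
  (forall g h, P g -> P h -> P (g + h)) ->
  (forall x a, P (pure_tensor x a)) -> forall g, P g.
Proof.
move=> PD Pp g; rewrite (adeleF_decomp g); elim/big_ind : _ => //.
have -> : 0 = pure_tensor 0 0 :> AF by rewrite /pure_tensor scale0r.
exact: Pp.
Qed.

Lemma adeleF_mulDl : left_distributive adeleF_mul +%R.
Proof. by move=> f g h; rewrite /adeleF_mul mulmxDl. Qed.

Lemma adeleF_mulDr : right_distributive adeleF_mul +%R.
Proof. by move=> f g h; rewrite /adeleF_mul adele_mult_mxD mulmxDr. Qed.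

Lemma adeleF_mulC : commutative adeleF_mul.
Proof.
move=> g h; move: g; apply: adeleF_ind => [g g' Pg Pg'|x a].
  by rewrite adeleF_mulDl adeleF_mulDr Pg Pg'.
move: h; apply: adeleF_ind => [h h' Ph Ph'|y b].
  by rewrite adeleF_mulDl adeleF_mulDr Ph Ph'.
by rewrite !adeleF_mul_pure mulrC (mulrC a).
Qed.

Lemma adeleF_mulA : associative adeleF_mul.
Proof.
move=> f g h; move: f; apply: adeleF_ind => [f f' Pf Pf'|x a].
  by rewrite !adeleF_mulDl Pf Pf'.
move: g; apply: adeleF_ind => [g g' Pg Pg'|y b].
  by rewrite adeleF_mulDl !adeleF_mulDr adeleF_mulDl Pg Pg'.
move: h; apply: adeleF_ind => [h h' Ph Ph'|z c].
  by rewrite !adeleF_mulDr Ph Ph'.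
by rewrite !adeleF_mul_pure !mulrA.
Qed.

Lemma adeleF_mul1 : left_id (pure_tensor 1 1) adeleF_mul.
Proof.
apply: adeleF_ind => [f g Pf Pg|x a]; first by rewrite adeleF_mulDr Pf Pg.
by rewrite adeleF_mul_pure !mul1r.
Qed.

Lemma adeleF_oner_neq0 : pure_tensor 1 1 != 0 :> AF.
Proof.
apply/eqP; rewrite /pure_tensor scale1r => c0.
have /eqP := oner_neq0 F; apply; rewrite [LHS]basis_coordE big1 // => i _.
have {}c0 : adele_rat (basis_coord 1 0 i) = 0.
  by have /rowP/(_ i) := c0; rewrite mxE => ->; rewrite mxE.
have [-> |r0] := eqVneq (basis_coord 1 0 i) 0; first by rewrite scale0r.
have : adele_rat ((basis_coord 1 0 i)^-1 * basis_coord 1 0 i) == 0.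
  by rewrite rmorphM /= c0 mulr0.
by rewrite mulVf // rmorph1 oner_eq0.
Qed.

HB.instance Definition _ := GRing.Zmodule_isComNzRing.Build AF
  adeleF_mulA adeleF_mulC adeleF_mul1 adeleF_mulDl adeleF_oner_neq0.
HB.instance Definition _ := GRing.ComNzRing_hasMulInverse.Build AF
  (@classical_mulVr AF) (@classical_unitPl AF) (@classical_inv_out AF).

Definition ring_of_integers : set F :=
  [set x | integralOver (intr : int -> F) x].

(* \hat{O}_F is the image of O_F \otimes_Z \hat{Z} in F \otimes_Q A_f.        *)
Definition Ohat : set AF :=
  [set g | exists (m : nat) (x : 'I_m -> F) (a : 'I_m -> adele),
    [/\ forall i, ring_of_integers (x i), forall i, zhat (a i) &
        g = \sum_i pure_tensor (x i) (a i)]].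

(* G(A_f), M(A_f) and K_M for the Bost-Connes pair of F; M(A_f) is all of     *)
(* A_{f,F}, included in End(V \otimes A_f) by bc_phi.                         *)
Definition bc_G : set AF := [set g | g \is a GRing.unit].

Definition bc_phi (g : AF) : 'M[adele]_n := adele_mult_mx g.

Definition bc_KM : set 'M[adele]_n := bc_phi @` Ohat.

Definition sym_f : set AF := [set g | bc_G g /\ bc_KM (bc_phi g)].

Definition sym_f_units : set AF :=
  [set u | sym_f u /\ exists2 v, sym_f v & u * v = 1].

Definition sym_f_orbits : set (set AF) :=
  [set [set u * g | u in sym_f_units] | g in sym_f].

(* The positive rational q such that \det (bc_phi g) lies in q \hat{Z}^*.     *)
Definition det_phi (g : AF) : rat :=
  xget 0 [set q : rat | 0 < q /\
    exists2 u, zhat_units u & \det (bc_phi g) = adele_rat q * u].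

Definition ideal_of_integers (I : set F) : Prop :=
  [/\ I `<=` ring_of_integers, I 0,
      forall x y, I x -> I y -> I (x + y) &
      forall a x, ring_of_integers a -> I x -> I (a * x)].

Definition nonzero_ideals : set (set F) :=
  [set I | ideal_of_integers I /\ exists2 x, I x & x != 0].

Definition ideal_cosets (I : set F) : set (set F) :=
  [set [set x + y | y in I] | x in ring_of_integers].

Definition ideal_norm (I : set F) : nat := #|` fset_set (ideal_cosets I)|.

End BaseChange.

Arguments ring_of_integers : clear implicits.
Arguments Ohat : clear implicits.
Arguments bc_G : clear implicits.
Arguments bc_KM : clear implicits.
Arguments sym_f : clear implicits.
Arguments sym_f_units : clear implicits.
Arguments sym_f_orbits : clear implicits.
Arguments nonzero_ideals : clear implicits.

Section Zeta.
Variables (R : realType) (F : fieldExtType rat).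
Local Notation C := R[i].

Definition cexp (z : C) : C :=
  (expR (complex.Re z))%:C%C * (cos (complex.Im z) +i* sin (complex.Im z))%C.

(* x ^ s for a positive real x, with the real logarithm.                      *)
Definition cpow (x : R) (s : C) : C := cexp (s * (ln x)%:C%C).

(* The term attached to a class is computed on a chosen representative; it is *)
(* the same for all of them.                                                  *)
Definition zeta_bc_term (s : C) (c : set (adeleF F)) : C^o :=
  cpow (ratr (det_phi (xget 0 c))) (- s).

Definition dedekind_term (s : C) (I : set F) : C^o :=
  cpow (ideal_norm I)%:R (- s).

Definition zeta_bc_converges (s : C) : Prop :=
  cvg (partial_sum (zeta_bc_term s \_ (sym_f_orbits F)) @ totally).

Definition dedekind_converges (s : C) : Prop :=
  cvg (partial_sum (dedekind_term s \_ (nonzero_ideals F)) @ totally).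

Definition zeta_bc (s : C) : C^o := sum (zeta_bc_term s \_ (sym_f_orbits F)).

Definition dedekind_zeta (s : C) : C^o :=
  sum (dedekind_term s \_ (nonzero_ideals F)).

End Zeta.

Arguments zeta_bc_term {R} F s c.
Arguments dedekind_term {R} F s I.
Arguments zeta_bc {R} F s.
Arguments dedekind_zeta {R} F s.
Arguments zeta_bc_converges {R} F s.
Arguments dedekind_converges {R} F s.

(* Main.v *)
Require Import Defs.
From HB Require Import structures.
From mathcomp Require Import all_boot all_order all_algebra all_field.
From mathcomp Require Import generic_quotient fraction mxpoly cyclic finmap.
From mathcomp Require Import all_classical all_reals all_analysis.
From mathcomp Require Import summability complex.
From mathcomp Require Import ring.

Set Implicit Arguments.
Unset Strict Implicit.
Unset Printing Implicit Defensive.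

Import Order.TTheory GRing.Theory Num.Theory.

Local Open Scope classical_set_scope.
Local Open Scope ring_scope.

(** Write O for the ring of integers of F and I(g) for the set of x in F with
    x (x) 1 in g \hat{O}. The description of the finite symmetry semigroup only
    says that an adele is determined by its multiplication operator. For the zeta
    functions, g |-> I(g) induces a bijection from the orbits of the units of
    the semigroup onto the nonzero ideals of O, and it carries det phi(g) to the
    norm of I(g). The two series are therefore the same family up to reindexing,
    and their nets of partial sums have the same image filter
    ([partial_sum_reindex]); hence both the convergence and the value of the
    limit operator agree at every s.

    The arithmetic rests on an integral basis of O ([integral_basis]). It exists
    because traces of integral elements are integers and the trace form is
    nondegenerate (the trace of x * x^-1 is the degree), so that O embeds in
    Z^n as a subgroup of finite index; such a subgroup has a basis, namely a
    family in it with least nonzero |det| ([lattice_basis]).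

    Since \hat{Z} = Z + m \hat{Z} for all m > 0, the ideal I(g) is dense in
    g \hat{O} ([ideal_of_hat]). So I(g) determines g up to a unit
    ([ideal_of_inj]). Moreover, in integral coordinates, the matrix A of
    multiplication by g and an integer matrix B whose rows span I(g) generate the
    same \hat{Z}-module: A = V B with det V in \hat{Z}^*, whence det phi(g) is
    |det B|, which is the index of I(g) in O by the Smith normal form
    ([det_phi_norm]).

    Surjectivity ([ideal_of_surj]) asks that an ideal I be locally principal. Let
    D > 1 be an integer in I. If g0 in I generates I at all primes dividing D
    ([ideal_local_generator]), then the adele g equal to g0 at those primes and
    to 1 at the others satisfies I(g) = I. Such a g0 is obtained without prime
    ideals: for every x in F the fractional ideal (1, x) is invertible, by the
    Kronecker argument on a primitive integer polynomial vanishing at x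
    ([ideal_mul_inv1]), and an idempotent of the finite ring O / D O then turns
    two generators into one ([intp_local_gcd]). *)

(** * Sums over reindexed families *)

Lemma partial_sum_patch (I : choiceType) (V : zmodType) (f : I -> V) (D : set I)
    (A : {fset I}) :
  partial_sum (patch (fun=> 0) D f) A = \sum_(i <- A | i \in D) f i.
Proof.
by rewrite /partial_sum big_seq_fsetE /= [RHS]big_mkcond.
Qed.

Section Reindex.
Variables (I J : choiceType) (K : numDomainType) (V : normedModType K).
Variables (f : I -> V) (g : J -> V) (D : set I) (E : set J).
Variables (h : I -> J) (k : J -> I).
Hypotheses (hE : forall i, D i -> E (h i)) (kD : forall j, E j -> D (k j)).
Hypotheses (hK : forall i, D i -> k (h i) = i) (kK : forall j, E j -> h (k j) = j).
Hypothesis fg : forall i, D i -> f i = g (h i).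

(** Given a finite set A of indices in I, the finite set h(A) works in J: each
    finite B containing h(A) has the same sum as the union of A and k(B). *)
Lemma partial_sum_reindex_sub :
  (partial_sum (patch (fun=> 0) D f) @ totally) `<=`
  (partial_sum (patch (fun=> 0) E g) @ totally).
Proof.
move=> S [A _ AS]; exists [fset h i | i in A & i \in D]%fset => // B /= AB.
have := AS (A `|` [fset k j | j in B & j \in E])%fset (fsubsetUl _ _).
rewrite /preimage /= !partial_sum_patch; set B' := (_ `|` _)%fset.
suff -> : \sum_(i <- B' | i \in D) f i = \sum_(j <- B | j \in E) g j by [].
rewrite big_mkcond -[LHS]big_mkcond -big_filter -[RHS]big_filter.
rewrite (eq_big_seq (g \o h)); last first.
  by move=> i; rewrite mem_filter => /andP[/set_mem Di _]; exact: fg.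
rewrite -(big_map h xpredT g); apply/perm_big/uniq_perm.
- rewrite map_inj_in_uniq ?filter_uniq ?fset_uniq // => i j.
  rewrite !mem_filter => /andP[/set_mem Di _] /andP[/set_mem Dj _] hij.
  by rewrite -(hK Di) hij hK.
- by rewrite filter_uniq ?fset_uniq.
move=> j; apply/mapP/idP => [[i iF ->]|].
  move: iF; rewrite !mem_filter => /andP[Di iB']; rewrite (mem_set (hE (set_mem Di))) /=.
  move: iB'; rewrite inE => /orP[iA|/imfsetP[l /= /andP[lB /set_mem El] ->]].
    by apply: (fsubsetP AB); apply/imfsetP; exists i => //=; rewrite !inE iA.
  by rewrite kK.
rewrite mem_filter => /andP[/[dup] jE /set_mem Ej jB]; exists (k j); last by rewrite kK.
rewrite mem_filter (mem_set (kD Ej)) /= inE; apply/orP; right.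
by apply/imfsetP; exists j => //=; rewrite !inE jB.
Qed.

End Reindex.

(** The image filters themselves agree, so convergence and the (total) limit
    operator are both transported, also for divergent families. *)
Lemma partial_sum_reindex (I J : choiceType) (K : numDomainType)
    (V : normedModType K) (f : I -> V) (g : J -> V) (D : set I) (E : set J)
    (h : I -> J) (k : J -> I) :
    (forall i, D i -> E (h i)) -> (forall j, E j -> D (k j)) ->
    (forall i, D i -> k (h i) = i) -> (forall j, E j -> h (k j) = j) ->
    (forall i, D i -> f i = g (h i)) ->
  partial_sum (patch (fun=> 0) D f) @ totally =
  partial_sum (patch (fun=> 0) E g) @ totally.
Proof.
move=> hE kD hK kK fg; apply/seteqP; split.
  exact: (partial_sum_reindex_sub hE kD hK kK fg).
apply: (partial_sum_reindex_sub kD hE kK hK) => j Ej.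
by rewrite fg ?kK //; exact: kD.
Qed.

(** * Integer lattices *)

(** Cramer's rule. *)
Lemma det_replace_row (A : comPzRingType) n (B : 'M[A]_n) (v : 'rV_n) i :
  \det (\matrix_j (if j == i then v else row j B)) = (v *m \adj B) 0%R i.
Proof.
set B' := \matrix_j _; rewrite (expand_det_row B' i) mxE; apply: eq_bigr => k _.
rewrite !mxE eqxx; congr (_ * (_ * \det _)); apply/matrixP => a b.
by rewrite !mxE eq_sym (negbTE (neq_lift _ _)) mxE.
Qed.

Lemma ltn_absz_mod (m d : int) : d != 0 -> (`|(m %% d)%Z| < `|d|)%N.
Proof. by move=> d0; rewrite -ltz_nat gez0_abs ?modz_ge0 //; exact: ltz_mod. Qed.

(** A subgroup L of Z^n containing d Z^n for some d != 0 is spanned by the rows of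
    a square matrix: take rows in L with the least nonzero |det|. If some v in L
    had a non-integral coordinate on these rows, subtracting the integral part and
    exchanging v for the corresponding row would give a smaller determinant. *)
Lemma lattice_basis n (L : 'rV[int]_n -> Prop) (d : int) :
    d != 0 -> (forall v, L (d *: v)) -> (forall u v, L u -> L v -> L (u - v)) ->
  exists2 B : 'M[int]_n, \det B != 0 &
    forall v, L v <-> exists z : 'rV[int]_n, v = z *m B.
Proof.
move=> d0 Ld LB; have L0 : L 0 by rewrite -(scaler0 _ d).
have LN u : L u -> L (- u) by rewrite -sub0r; exact: LB.
have LD u v : L u -> L v -> L (u + v) by move=> Lu Lv; rewrite -[v]opprK; apply/LB/LN.
have LZ (z : int) u : L u -> L (z *: u).
  move=> Lu; have LZn (m : nat) : L (m%:Z *: u).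
    elim: m => [|m IHm]; first by rewrite scale0r.
    by rewrite intS scalerDl scale1r; apply: LD.
  by case: z => m //; rewrite NegzE scaleNr; apply/LN/LZn.
(* P m: some family of n vectors of L has determinant m in absolute value *)
pose P m := `[< exists B : 'M[int]_n,
  [/\ forall i, L (row i B), \det B != 0 & m = `|\det B|%N] >].
have exP : exists m, P m.
  exists `|\det (d%:M : 'M[int]_n)|%N; apply/asboolP; exists d%:M; split=> //.
    by move=> i; rewrite -scalemx1 linearZ; exact: Ld.
  by rewrite det_scalar expf_neq0.
case: (ex_minnP exP) => m /asboolP[B [LB_row B0 ->]] minB; exists B => // v; split; last first.
  move=> [z ->]; rewrite mulmx_sum_row; elim/big_ind: _ => // i _.
  exact/LZ/LB_row.
move=> Lv; pose D := \det B.
have dvd i : (D %| (v *m \adj B) 0%R i)%Z.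
  pose q := ((v *m \adj B) 0%R i %/ D)%Z; pose v' := v - q *: row i B.
  pose B' := \matrix_j (if j == i then v' else row j B).
  have LB' j : L (row j B').
    by rewrite rowK; case: eqP => // _; apply: LB => //; apply/LZ/LB_row.
  (* v' has the coordinate ((v *m \adj B) 0 i mod D) / D on row i *)
  have dB' : \det B' = ((v *m \adj B) 0%R i %% D)%Z.
    rewrite det_replace_row mulmxBl -scalemxAl -row_mul mul_mx_adj.
    have -> (w : 'rV[int]_n) : (w - q *: row i D%:M) 0 i = w 0 i - q * D.
      by rewrite !mxE eqxx mulr1n.
    by rewrite [X in X - _](divz_eq _ D) addrAC subrr add0r.
  apply/dvdz_mod0P; rewrite -dB'; apply: contrapT => /eqP B'0.
  have /minB : P `|\det B'|%N by apply/asboolP; exists B'.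
  by rewrite leqNgt dB' ltn_absz_mod.
exists (\row_i ((v *m \adj B) 0%R i %/ D)%Z).
have scaleI (u w : 'rV[int]_n) : D *: u = D *: w -> u = w.
  by move=> /rowP e; apply/rowP => i; move: (e i); rewrite !mxE => /(mulfI B0).
apply: scaleI; rewrite scalemxAl.
rewrite -mul_mx_scalar -(mul_adj_mx B) mulmxA; congr (_ *m _); apply/rowP => i.
by rewrite [RHS]mxE [X in _ * X]mxE mulrC divzK.
Qed.

(** The subgroup spanned by the rows of B has index |det B| in Z^n: the vectors
    [r t] form a system of representatives of the cosets. *)
Lemma lattice_index n (B : 'M[int]_n) : \det B != 0 ->
  exists (T : finType) (r : T -> 'rV[int]_n),
  [/\ #|T| = `|\det B|%N,
      forall t u (z : 'rV[int]_n), r t - r u = z *m B -> t = u &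
      forall v, exists t (z : 'rV[int]_n), v - r t = z *m B].
Proof.
have [P uP [Q uQ [d _ defB]]] := int_Smith_normal_form B.
pose D := diag_mx (\row_i d`_i) : 'M[int]_n.
have {}defB : B = P *m D *m Q.
  by rewrite [LHS]defB; congr (_ *m _ *m _); apply/matrixP => i j; rewrite !mxE.
have absu (U : 'M[int]_n) : U \in unitmx -> `|\det U|%N = 1%N.
  rewrite unitmxE => /unitrP[y [yU _]]; have := congr1 absz yU.
  by rewrite abszM => /eqP; rewrite muln_eq1 => /andP[_ /eqP].
have detB : `|\det B|%N = (\prod_(i < n) `|(d`_i : int)|)%N.
  rewrite defB !det_mulmx !abszM (absu P uP) (absu Q uQ) mul1n muln1 det_diag.
  by elim/big_ind2: _ => // [x a y b|i _]; [rewrite abszM => -> -> | rewrite mxE].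
move=> B0; have d0 (i : 'I_n) : d`_i != 0 :> int.
  move: B0; rewrite -absz_eq0 detB -lt0n; apply: contraTneq => di0.
  by rewrite (bigD1 i) //= di0 mul0n.
exists {dffun forall i : 'I_n, 'I_`|(d`_i : int)|}.
exists (fun t : {dffun forall i : 'I_n, 'I_`|(d`_i : int)|} =>
  \row_i (nat_of_ord (t i))%:Z *m Q); split.
- rewrite card_dep_ffun detB foldrE big_map big_enum /=.
  by apply: eq_bigr => i _; rewrite card_ord.
- move=> t u z e; apply/ffunP => i; apply/val_inj/eqP.
  have {}e : \row_i (nat_of_ord (t i))%:Z - \row_i (nat_of_ord (u i))%:Z = z *m P *m D.
    by apply: (can_inj (mulmxK uQ)); rewrite mulmxBl e defB !mulmxA.
  have /eqP := congr1 (fun v : 'rV[int]_n => v 0 i) e; rewrite mul_mx_diag !mxE subr_eq.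
  move=> /eqP e1; rewrite -eqz_nat.
  have small (k : 'I_`|(d`_i : int)|) : ((k : nat) %% d`_i)%Z = k.
    by rewrite -modz_abs modz_nat modn_small.
  by rewrite -(small (t i)) -(small (u i)) e1 modzMDl.
- move=> v; pose w := v *m invmx Q.
  have lt i : (`|(w 0%R i %% (d`_i : int))%Z| < `|(d`_i : int)|)%N.
    exact: ltn_absz_mod.
  exists [ffun i => Ordinal (lt i)], ((\row_i (w 0%R i %/ (d`_i : int))%Z) *m invmx P).
  rewrite defB !mulmxA mulmxKV // -[v](mulmxKV uQ) -/w -mulmxBl; congr (_ *m _).
  move: w lt => w lt; apply/rowP => i; rewrite mul_mx_diag !mxE ffunE /=.
  by rewrite gez0_abs ?modz_ge0 // [X in X - _](divz_eq _ d`_i) addrK.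
Qed.

(** * Finite adeles of the rationals *)

Lemma fraction_numden (A : idomainType) (x : {fraction A}) :
  exists (n d : A), d != 0 /\ x * FracField.tofrac d = FracField.tofrac n.
Proof.
elim/quotW: x => y; exists (frac y).1, (frac y).2; split; first exact: denom_ratioP.
rewrite [LHS]/GRing.mul /= !piE /FracField.mulf; apply/eqmodP => /=.
by rewrite FracField.equivfE !numden_Ratio ?oner_neq0 ?mulr1 ?denom_ratioP // mulrC.
Qed.

Section LocalIntegers.
Variable p : prime_nat.
Local Notation q := (val p).

(** The entry of index 1 of a p-adic integer is its residue modulo p. *)
Lemma padic_unit_mod (c : padic_int p) : c 1%N != 0%N -> c \is a GRing.unit.
Proof.
(* the inverse of c modulo q ^ n is a power of c, by Euler's theorem *)
move=> c1; pose v n := (c n ^ (totient (q ^ n)).-1)%N.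
have cop n : coprime (c n) (q ^ n).
  case: n => [|n]; first by rewrite expn0 coprimen1.
  rewrite coprimeXr // coprime_sym prime_coprime ?padic_pr //.
  by apply: contra c1 => /eqP; rewrite -(padic_mod_le c (ltn0Sn n)) expn1 => ->.
have vP n : (c n * v n = 1 %[mod q ^ n])%N.
  by rewrite /v -expnS prednK ?totient_gt0 ?padic_expn_gt0 // Euler_exp_totient.
have vS n : (v n.+1 = v n %[mod q ^ n])%N.
  have vS1 : (c n * v n.+1 = 1 %[mod q ^ n])%N.
    rewrite -(padicE c n) modnMml.
    by rewrite -(@modn_dvdm (q ^ n.+1)) ?vP ?modn_dvdm // dvdn_exp2l.
  rewrite -[in LHS](muln1 (v n.+1)) -modnMmr -vP modnMmr mulnA (mulnC _ (c n)).
  by rewrite -modnMml vS1 modnMml mul1n.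
apply/unitrP; exists (padic_mk vS); rewrite mulrC.
suff -> : c * padic_mk vS = 1 by [].
by apply: padicP => n; rewrite padic_seqM /= modnMmr vP.
Qed.

Lemma padic_divp (b : padic_int p) : b 1%N = 0%N ->
  exists2 c, b = q%:R * c & forall n, b n.+1 = (q * c n)%N.
Proof.
move=> b1; have q0 : (0 < q)%N by rewrite prime_gt0 ?padic_pr.
have dvd n : (q %| b n.+1)%N.
  by apply/eqP; rewrite -{1}(expn1 q) padic_mod_le.
have cS n : (b n.+2 %/ q = b n.+1 %/ q %[mod q ^ n])%N.
  by rewrite !modn_divl -expnSr padicE padic_mod.
have bE n : b n.+1 = (q * padic_mk cS n)%N.
  by rewrite /= modn_divl -expnSr padic_mod mulnC divnK.
exists (padic_mk cS) => //; apply: padicP => n.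
rewrite padic_seqM padic_seq_nat modnMml.
by rewrite -(padicE b n) bE.
Qed.

Lemma padic_sub_residue (c : padic_int p) : (c - (c 1%N)%:R) 1%N = 0%N.
Proof.
set e := c - _; have eE : ((e 1 + c 1) %% q = c 1)%N.
  have : (e + (c 1%N)%:R) 1%N = c 1%N by rewrite subrK.
  by rewrite padic_seqD padic_seq_nat expn1 modnDmr.
have : (e 1 + c 1 == 0 + c 1 %[mod q])%N by rewrite eE add0n -(expn1 q) padic_mod.
by rewrite eqn_modDr mod0n -(expn1 q) padic_mod => /eqP.
Qed.

(** A nonzero p-adic integer is a power of p times a unit, so it divides a positive
    natural number. *)
Lemma padic_dvd_nat (b : padic_int p) : b != 0 ->
  exists2 m : nat, (0 < m)%N & exists c, m%:R = b * c.
Proof.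
move=> b0; have [n bn] : exists n, b n != 0%N.
  apply: contrapT => /forallNP bz; move/eqP: b0; apply; apply: padicP => n.
  by rewrite padic_seq0; apply/eqP/negPn/negP/bz.
elim: n b bn {b0} => [|n IHn] b bn; first by move: bn; rewrite -padic_mod expn0 modn1.
have [/padic_divp[c bE bS]|/padic_unit_mod ub] := eqVneq (b 1%N) 0%N; last first.
  by exists 1%N => //; exists b^-1; rewrite divrr.
have /IHn[m m0 [c' mE]] : c n != 0%N by apply: contraNneq bn => cn; rewrite bS cn muln0.
exists (q * m)%N; first by rewrite muln_gt0 m0 prime_gt0 // padic_pr.
by exists c'; rewrite natrM mE bE mulrA.
Qed.

Lemma padic_integral_inv (m : nat) : coprime q m ->
  padic_integral (ratr m%:R^-1 : padic p).
Proof.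
move=> qm; have um := padic_unit_coprime qm; exists (m%:R^-1).
have m0 : (m%:R : padic p) != 0.
  by rewrite -(rmorph_nat (@FracField.tofrac (padic_int p))) tofrac_eq0;
     apply: contraTneq um => ->; rewrite unitr0.
apply: (mulIf m0); rewrite -[in RHS](rmorph_nat (@FracField.tofrac (padic_int p))).
rewrite -rmorphM mulVr // rmorph1.
have m0' : m%:~R != 0 :> rat.
  by rewrite intr_eq0; apply: contraNneq m0 => -[->].
have -> : m%:R^-1 = 1%:~R / m%:~R :> rat by rewrite mul1r.
rewrite ratr_frac; last by rewrite -(intr_eq0 rat).
  by rewrite mulfVK.
exact: padic_frac_intr_eq0.
Qed.

Lemma padic_integral_mul_nat (x : padic p) :
  exists2 m : nat, (0 < m)%N & padic_integral (m%:R * x).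
Proof.
have [n [d [d0 xd]]] := fraction_numden x; have [m m0 [c mE]] := padic_dvd_nat d0.
exists m => //; exists (n * c).
rewrite -(rmorph_nat (@FracField.tofrac (padic_int p))) mE !rmorphM /=.
by rewrite -xd mulrAC [x * _]mulrC.
Qed.

End LocalIntegers.

(** ** The profinite integers *)

(** The profinite integers as a boolean predicate, so as to register them as a
    subring. *)
Definition zhatp : {pred adele} := fun a => `[< zhat a >].

Lemma zhatP (a : adele) : reflect (zhat a) (a \in zhatp).
Proof. exact: asboolP. Qed.

Lemma zhatp_subring : subring_closed zhatp.
Proof.
split=> [|a b /zhatP az /zhatP bz|a b /zhatP az /zhatP bz]; apply/zhatP => p.
- by exists 1; rewrite rmorph1 /= ratr1.
- exact: padic_integralD (az p) (padic_integralN (bz p)).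
- exact: padic_integralM (az p) (bz p).
Qed.
HB.instance Definition _ := GRing.isSubringClosed.Build adele zhatp zhatp_subring.

Lemma det_closed (A : comPzRingType) (S : subringClosed A) n (M : 'M[A]_n) :
  (forall i j, M i j \in S) -> \det M \in S.
Proof.
by move=> MS; apply: rpred_sum => s _; rewrite rpredMsign; apply: rpred_prod.
Qed.

Lemma adele_rat_num (z : int) : adele_rat z%:~R = z%:~R.
Proof. exact: rmorph_int. Qed.

Lemma zhat_intr (z : int) : adele_rat z%:~R \in zhatp.
Proof. by rewrite adele_rat_num rpred_int. Qed.

(** A rational number that is integral at every prime is an integer. *)
Lemma zhat_rat (r : rat) : adele_rat r \in zhatp -> r \is a Num.int.
Proof.
move=> /zhatP rz; rewrite Qint_def; apply: contrapT => d1.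
have d1' : (1 < `|denq r|)%N.
  rewrite ltn_neqAle absz_gt0 denq_neq0 andbT; apply/eqP => e; apply: d1.
  by rewrite -(gez0_abs (denq_ge0 r)) -e.
pose p : prime_nat := exist _ (pdiv `|denq r|) (pdiv_prime d1').
have [a /= ra] := rz p.
have e : (numq r)%:~R = a * `|denq r|%:R :> padic_int p.
  apply/eqP; rewrite -tofrac_eq rmorphM rmorph_int rmorph_nat /= -ra /ratr.
  by rewrite pmulrn gez0_abs ?denq_ge0 // divfK // padic_frac_intr_eq0 denq_neq0.
have un : (numq r)%:~R \is a @GRing.unit (padic_int p).
  rewrite [numq r]intEsign intrM rmorph_sign unitrM.
  apply/andP; split; first by rewrite unitrX // unitrN1.
  apply: padic_unit_coprime; rewrite coprime_sym.
  by apply: coprime_dvdr (pdiv_dvd _) (coprime_num_den r).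
have ud : `|denq r|%:R \is a @GRing.unit (padic_int p).
  by move: un; rewrite e unitrM => /andP[].
have [m dE] := dvdnP (pdiv_dvd `|denq r|).
move: ud; rewrite dE natrM unitrM => /andP[_ /unitrP[y [yq _]]].
have /(congr1 (fun x : padic_int p => x 1%N)) := yq.
rewrite padic_seqM padic_seq_nat expn1 modnn muln0 mod0n -[1]/(1%:R) padic_seq_nat.
by rewrite expn1 modn_small // prime_gt1 ?padic_pr.
Qed.

Lemma adele_nat_at (k : nat) (p : prime_nat) : (k%:R : adele) p = k%:R.
Proof.
elim: k => [|k IHk]; first by rewrite [LHS]/(ratr 0) /ratr mul0r.
by rewrite mulrS [LHS]/(ratr 1 + (k%:R : adele) p) ratr1 IHk mulrS.
Qed.

(** Division by m preserves the profinite integers that vanish at the primes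
    dividing m. *)
Lemma zhat_inv (m : nat) (a : adele) :
    (forall p : prime_nat, ~~ coprime (val p) m -> a p = 0) -> zhat a ->
  adele_rat m%:R^-1 * a \in zhatp.
Proof.
move=> a0 az; apply/zhatP => p.
have [pm|/a0 ap0] := boolP (coprime (val p) m); last first.
  by exists 0; rewrite rmorph0 -[LHS]/(_ * a p) ap0 mulr0.
exact: padic_integralM (padic_integral_inv pm) (az p).
Qed.

(** The density of Z in \hat{Z}, in the form \hat{Z} = Z + m \hat{Z}; the prime
    factors of m are treated one at a time. *)
Lemma zhat_approx (m : nat) (a : adele) : (0 < m)%N -> a \in zhatp ->
  exists (z : int) (b : adele), b \in zhatp /\ a = z%:~R + m%:R * b.
Proof.
elim/ltn_ind: m a => m IHm a m0 az.
have [m1|m1] := leqP m 1%N.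
  have {m0 m1 IHm}-> : m = 1%N by apply/eqP; rewrite eqn_leq m1.
  by exists 0, a; rewrite mul1r add0r.
pose p : prime_nat := exist _ (pdiv m) (pdiv_prime m1).
have [k mE] := dvdnP (pdiv_dvd m).
have [k0 p1] : (0 < k)%N /\ (1 < pdiv m)%N.
  by split; [move: m0; rewrite mE; case: k {mE} | exact: prime_gt1 (valP p)].
have [c ac] := (zhatP _ az) p.
pose b := adele_rat (pdiv m)%:R^-1 * (a - (c 1%N)%:R).
have bE : a = (c 1%N)%:R + (pdiv m)%:R * b.
  rewrite /b mulrA -[(pdiv m)%:R](rmorph_nat adele_rat) -rmorphM mulfV.
    by rewrite rmorph1 mul1r addrC subrK.
  by rewrite pnatr_eq0 -lt0n ltnW.
have bz : b \in zhatp.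
  apply/zhatP => p'; have [pp'|] := boolP (coprime (val p') (pdiv m)).
    apply: padic_integralM (padic_integral_inv pp') _.
    by move: p' {pp'}; apply/zhatP; rewrite rpredB // rpred_nat.
  rewrite prime_coprime ?padic_pr // negbK dvdn_prime2 ?(valP p) ?padic_pr // => /eqP e.
  have {e}-> : p' = p by apply: val_inj.
  have [d dE _] := padic_divp (padic_sub_residue c).
  exists d; apply: (mulfI (_ : (pdiv m)%:R != 0)).
    by rewrite pmulrn padic_frac_intr_eq0 -lt0n ltnW.
  transitivity ((a - (c 1%N)%:R) p).
    by rewrite [in RHS]bE addrAC subrr add0r -(adele_nat_at _ p).
  transitivity (FracField.tofrac (c - (c 1%N)%:R)).
    by rewrite rmorphB rmorph_nat /= -ac -(adele_nat_at _ p).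
  by rewrite dE rmorphM rmorph_nat.
have km : (k < m)%N by rewrite [X in (_ < X)%N]mE ltn_Pmulr.
have [z [b' [b'z b'E]]] := IHm k km b k0 bz.
exists ((c 1%N)%:Z + z * (pdiv m)%:Z), b'; split=> //.
have -> : m%:R = (pdiv m)%:R * k%:R :> adele by rewrite -natrM mulnC -mE.
by rewrite bE b'E mulrDr addrA intrD intrM mulrA; congr (_ + _ + _); exact: mulrC.
Qed.

Lemma adele_denominator (a : adele) :
  exists2 m : nat, (0 < m)%N & m%:R * a \in zhatp.
Proof.
have /choice[m mP] (p : prime_nat) : exists m : nat,
  (0 < m)%N /\ padic_integral (m%:R * a p).
  by have [m ? ?] := padic_integral_mul_nat (a p); exists m.
pose s := fset_set [set p | ~ padic_integral (a p)].
exists (\prod_(p <- s) m p)%N; first by rewrite prodn_gt0 // => p; case: (mP p).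
apply/zhatP => p; rewrite -[X in padic_integral X]/(_ p * a p) adele_nat_at.
have nat_int k : padic_integral (k%:R : padic p) by exists k%:R; rewrite rmorph_nat.
have [ps|ps] := boolP (p \in s).
  rewrite (big_fsetD1 p) //= mulnC natrM -mulrA.
  by apply: padic_integralM => //; case: (mP p).
apply: padic_integralM => //; apply: contrapT => ap; move/negP: ps; apply.
by rewrite in_fset_set ?inE //; exact: adele_finite.
Qed.

Lemma adele_at_subproof (D : nat) :
  `[< finite_set [set p : prime_nat |
      ~ padic_integral ((val p %| D)%N%:R : padic p)] >].
Proof.
apply/asboolP/(sub_finite_set _ (finite_set0 _)) => p /= [].
by exists (val p %| D)%N%:R; rewrite rmorph_nat.
Qed.

(** The idempotent of the finite adeles that is 1 at the primes dividing D and
    0 at the other primes. *)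
Definition adele_at (D : nat) : adele := Adele (adele_at_subproof D).

Lemma adele_at_idem D : adele_at D * adele_at D = adele_at D.
Proof.
apply: adeleP => p; have idem (b : bool) : b%:R * b%:R = b%:R :> padic p.
  by case: b; rewrite ?mulr1 ?mulr0.
exact: idem.
Qed.

Lemma adele_at_zhat D : adele_at D \in zhatp.
Proof.
by apply/zhatP => p /=; exists (val p %| D)%N%:R; rewrite rmorph_nat.
Qed.

Lemma adele_at_inv D k : coprime k D -> adele_rat k%:R^-1 * adele_at D \in zhatp.
Proof.
move=> kD; apply: zhat_inv (zhatP _ (adele_at_zhat D)) => p pk /=.
case: (boolP (_ %| D)%N) => // pD; case/negP: pk; rewrite coprime_sym.
exact: coprime_dvdr kD.
Qed.

Lemma adele_away_inv D : (0 < D)%N ->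
  adele_rat D%:R^-1 * (1 - adele_at D) \in zhatp.
Proof.
move=> D0; apply: zhat_inv => [p pD|]; last first.
  by apply/zhatP; rewrite rpredB ?rpred1 // adele_at_zhat.
have e1 : adele_at D p = 1.
  by move: pD => /=; rewrite prime_coprime ?padic_pr // negbK => ->.
by rewrite [LHS]/(ratr 1 - adele_at D p) ratr1 e1; exact: subrr.
Qed.

(** * The ring of integers of a number field *)

Section RingOfIntegers.
Variable F : fieldExtType rat.
Local Notation n := (\dim {:F}).
Local Notation e := (vbasis {:F}).

Lemma intrF_eq0 (z : int) : (z%:~R == 0 :> F) = (z == 0).
Proof. by rewrite -(rmorph_int (in_alg F)) fmorph_eq0 intr_eq0. Qed.

(** The ring of integers as a boolean predicate, so as to register it as a
    subring. *)
Definition intp : {pred F} := fun x => `[< ring_of_integers F x >].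

Lemma intpP x : reflect (ring_of_integers F x) (x \in intp).
Proof. exact: asboolP. Qed.

Lemma intp_subring : subring_closed intp.
Proof.
split=> [|x y /intpP ox /intpP oy|x y /intpP ox /intpP oy]; apply/intpP.
- exact: integral1.
- exact: integral_sub.
- exact: integral_mul.
Qed.
HB.instance Definition _ := GRing.isSubringClosed.Build F intp intp_subring.

Lemma intp_root (P : {poly F}) x :
  P \is monic -> P \is a polyOver intp -> root P x -> x \in intp.
Proof.
move=> P1 PO Px; apply/intpP/(integral_root_monic P1 Px) => y /(nthP 0)[i _ <-].
exact/intpP/(polyOverP PO).
Qed.

(** If P(x) = 0 with P of degree at most m and integral coefficients, then the
    product of x by the coefficient c of degree m is integral, as a root of
    the monic polynomial c^(m-1) P(X / c). *)
Lemma intp_lead (P : {poly F}) m x : P \is a polyOver intp ->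
  (size P <= m.+1)%N -> root P x -> P`_m * x \in intp.
Proof.
case: m => [|m] PO sP Px.
  have PE : P = (P`_0)%:P by apply: size1_polyC.
  by move: Px; rewrite PE rootC coefC eqxx => /eqP ->; rewrite mul0r rpred0.
set c := P`_m.+1; pose Q : {poly F} := 'X^(m.+1) + \poly_(i < m.+1) (P`_i * c ^+ (m - i)).
have PO' := polyOverP PO.
apply: (@intp_root Q).
- rewrite monicE lead_coefDl ?lead_coefXn //.
  by rewrite size_polyXn ltnS size_poly.
- rewrite rpredD ?rpredX ?polyOverX //; apply/polyOverP => i; rewrite coef_poly.
  by case: ifP => _; rewrite ?rpred0 ?rpredM ?rpredX ?PO'.
rewrite rootE hornerD hornerXn horner_poly.
have := rootP Px; rewrite (horner_coef_wide _ sP) big_ord_recr /= -/c => Px0.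
suff -> : \sum_(i < m.+1) P`_i * c ^+ (m - i) * (c * x) ^+ i =
    c ^+ m * \sum_(i < m.+1) P`_i * x ^+ i.
  by rewrite addrC exprMn exprSr -mulrA -mulrDr [X in _ * X](_ : _ = 0) ?mulr0.
rewrite mulr_sumr.
 apply: eq_bigr => i _; rewrite exprMn [in RHS]mulrCA -!mulrA; congr (_ * _).
  by rewrite !mulrA -exprD subnK // -ltnS.
Qed.

(** The product of the fractional ideal (1, x) = O + x O and of its inverse
    J, the set of the s in O with x s in O: the elements s + x t with
    s and t in J. *)
Definition ideal_mul_inv (x a : F) : Prop :=
  exists s t, [/\ [/\ s \in intp & x * s \in intp], [/\ t \in intp & x * t \in intp] &
                  a = s + x * t].

Lemma ideal_mul_invB x a b :
  ideal_mul_inv x a -> ideal_mul_inv x b -> ideal_mul_inv x (a - b).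
Proof.
move=> [s [t [[s1 s2] [t1 t2] ->]]] [s' [t' [[s1' s2'] [t1' t2'] ->]]].
exists (s - s'), (t - t'); rewrite !mulrBr !rpredB //; split=> //.
by rewrite opprD addrACA.
Qed.

(** Kronecker's argument: if c X^m is the leading term of P, then c x is
    integral, so c lies in J, and P - c X^m + c x X^(m-1) has lower degree,
    integral coefficients and the same root. *)
Lemma ideal_mul_inv_coef (P : {poly F}) x i : P \is a polyOver intp ->
  root P x -> ideal_mul_inv x P`_i.
Proof.
have [m] := ubnP (size P); elim: m P i => // m IHm P i sP PO Px.
have cp0 : ideal_mul_inv x 0.
  by exists 0, 0; rewrite !mulr0 addr0 !rpred0.
have [m0|m0] := posnP m.
  have -> : P = 0 by apply/size_poly_leq0P; rewrite -m0.
  by rewrite coef0.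
have [k mk] : exists k, m = k.+1 by case: m m0 {IHm sP} => // k; exists k.
move: IHm sP; rewrite {m m0}mk => IHm; rewrite ltnS => sP.
have cx := intp_lead PO sP Px; set c := P`_k in cx.
have cO : c \in intp := polyOverP PO k.
have cpc : ideal_mul_inv x c by exists c, 0; rewrite !mulr0 addr0 !rpred0 mulrC.
have cpxc : ideal_mul_inv x (c * x) by exists 0, c; rewrite !mulr0 add0r !rpred0 mulrC.
(* for k = 0 the polynomial is constant and c is its only coefficient *)
case: k IHm sP @c cx cO cpc cpxc => [|k] IHm sP c cx cO cpc cpxc.
  have PE : P = c%:P by apply: size1_polyC.
  by rewrite PE coefC; case: eqP.
pose Q : {poly F} := P - c *: 'X^(k.+1) + (c * x) *: 'X^k.
have QO : Q \is a polyOver intp.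
  by rewrite rpredD ?rpredB ?polyOverZ ?rpredX ?polyOverX.
have Qx : root Q x.
  by rewrite rootE !hornerE (rootP Px) sub0r exprS mulrA addNr.
have sQ : (size Q < k.+2)%N.
  rewrite ltnS; apply/leq_sizeP => j kj; rewrite !coefE.
  have [->|jk] := eqVneq j k.+1; first by rewrite mulr1 subrr gtn_eqF // mulr0 addr0.
  rewrite mulr0 subr0 (gtn_eqF kj) mulr0 addr0; apply: (leq_sizeP _ _ sP).
  by rewrite ltn_neqAle eq_sym jk.
have cpB := @ideal_mul_invB x; have cpN a : ideal_mul_inv x a -> ideal_mul_inv x (- a).
  by move=> xa; rewrite -sub0r; exact: cpB.
have PE : P = Q - (c * x) *: 'X^k - (- c) *: 'X^(k.+1).
  by rewrite /Q addrK scaleNr opprK subrK.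
have cpM a b (l : nat) : ideal_mul_inv x a -> ideal_mul_inv x (a * (b == l :> nat)%:R).
  by case: (b == l) => xa; rewrite ?mulr1 ?mulr0.
rewrite PE !coefB !coefZ !coefXn; apply: (cpB); last exact/cpM/cpN.
by apply: (cpB); [exact: IHm | exact: cpM].
Qed.

Lemma int_poly_root (x : F) : exists2 q : {poly int},
  q != 0 & root (map_poly intr q) x.
Proof.
have /polyOver1P[p pE] := minPolyOver 1 x.
have [q [a a0 qE]] := rat_poly_scale p.
have p0 : p != 0.
  apply: contraTneq (monic_minPoly 1 x) => p0.
  by rewrite pE p0 map_poly0 monicE lead_coef0 eq_sym oner_eq0.
exists q; first by apply: contraNneq p0 => q0; rewrite qE q0 map_poly0 scaler0.
have := root_minPoly 1 x; rewrite pE qE map_polyZ rootZ.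
  rewrite -map_poly_comp; congr (root _ x); apply: eq_map_poly => z /=.
  by rewrite scaler_int.
by rewrite fmorph_eq0 invr_eq0 intr_eq0.
Qed.

(** Every fractional ideal (1, x) is invertible: the coefficients of a primitive
    integer polynomial vanishing at x have greatest common divisor 1. *)
Lemma ideal_mul_inv1 x : ideal_mul_inv x 1.
Proof.
have [q0 q00 q0x] := int_poly_root x.
pose q := zprimitive q0; pose P : {poly F} := map_poly intr q.
have qx : root P x.
  move: q0x; rewrite [q0]zpolyEprim map_polyZ rootZ //.
  by rewrite /= intrF_eq0 zcontents_eq0.
have PO : P \is a polyOver intp.
  by apply/polyOverP => i; rewrite coef_map /= rpred_int.
have cpq i : ideal_mul_inv x (q`_i)%:~R.
  by have := ideal_mul_inv_coef i PO qx; rewrite coef_map.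
have cpB := @ideal_mul_invB x.
have cp0 : ideal_mul_inv x 0 by exists 0, 0; rewrite !mulr0 addr0 !rpred0.
have cpZ (z : int) a : ideal_mul_inv x a -> ideal_mul_inv x (z%:~R * a).
  move=> [s [t [[s1 s2] [t1 t2] ->]]]; exists (z%:~R * s), (z%:~R * t).
  have zO b : b \in intp -> z%:~R * b \in intp by apply: rpredM; apply: rpred_int.
  by split; [split| split |]; rewrite 1?[x * (_ * _)]mulrCA ?zO // mulrDr.
have cpD a b : ideal_mul_inv x a -> ideal_mul_inv x b -> ideal_mul_inv x (a + b).
  by move=> xa xb; rewrite -[b]opprK; apply: (cpB) => //; rewrite -sub0r; exact: cpB.
have cpg : ideal_mul_inv x (\big[gcdn/0%N]_(i < size q) `|(q`_i)%R|%N)%:~R.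
  elim/big_ind: _ => // [k l xk xl|i _].
    have [u [v uv]] := Bezoutz k l.
    have -> : Posz (gcdn k l) = u * k + v * l by rewrite uv.
    by rewrite intrD !intrM; apply: cpD; exact: cpZ.
  by rewrite abszEsg intrM; apply: cpZ.
have := cpZ (sgz (lead_coef q)) _ cpg.
by rewrite -intrM -/(zcontents q) zcontents_primitive q00.
Qed.

Lemma int_multiple (x : F) : exists2 m : int, m != 0 & m%:~R * x \in intp.
Proof.
have [q q0 qx] := int_poly_root x; exists (lead_coef q); first by rewrite lead_coef_eq0.
have PO : map_poly intr q \is a polyOver intp.
  by apply/polyOverP => i; rewrite coef_map /= rpred_int.
have := @intp_lead _ (size q).-1 x PO _ qx; rewrite coef_map /= -lead_coefE.
by apply; apply: leq_trans (size_poly _ _) (leqSpred _).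
Qed.

(** ** Coordinates and multiplication matrices *)

(** The element of F with given coordinates on the rational basis. *)
Definition of_coord (v : 'rV[rat]_n) : F := \sum_i v 0 i *: e`_i.

Lemma basis_coordK : cancel (@basis_coord F) of_coord.
Proof. by move=> x; rewrite [RHS](basis_coordE x). Qed.

Lemma of_coordK : cancel of_coord (@basis_coord F).
Proof.
move=> v; apply/rowP => j; rewrite mxE coord_sum_free //.
exact: basis_free (vbasisP _).
Qed.

Lemma basis_coord_is_linear : linear (@basis_coord F).
Proof. by move=> a x y; apply/rowP => j; rewrite !mxE linearP. Qed.
HB.instance Definition _ :=
  GRing.isLinear.Build rat F 'rV[rat]_n _ (@basis_coord F) basis_coord_is_linear.

Lemma mult_mx_inj (A B : 'M[rat]_n) :
  (forall y, basis_coord y *m A = basis_coord y *m B) -> A = B.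
Proof.
move=> AB; apply/row_matrixP => i; rewrite !rowE -(of_coordK (delta_mx 0 i)).
exact: AB.
Qed.

Lemma mult_mx_is_linear : linear (@mult_mx F).
Proof.
move=> a x y; apply: mult_mx_inj => z.
rewrite mulmxDr -scalemxAr !basis_coord_mul -linearP; congr basis_coord.
by rewrite mulrDr scalerAr.
Qed.
HB.instance Definition _ :=
  GRing.isLinear.Build rat F 'M[rat]_n _ (@mult_mx F) mult_mx_is_linear.

Lemma mult_mxM (x y : F) : mult_mx (x * y) = mult_mx x *m mult_mx y.
Proof. by apply: mult_mx_inj => z; rewrite mulmxA !basis_coord_mul mulrA. Qed.

Lemma mult_mx1 : mult_mx (1 : F) = 1%:M.
Proof. by apply: mult_mx_inj => z; rewrite basis_coord_mul mulmx1 mulr1. Qed.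

Lemma mult_mx_eigen (x : F) (q : {poly int}) (r : algC) (v : 'rV[algC]_n) :
  v *m map_mx ratr (mult_mx x) = r *: v ->
  v *m map_mx ratr (mult_mx (map_poly intr q).[x]) = (map_poly intr q).[r] *: v.
Proof.
move=> vr; elim/poly_ind: q => [|q c IHq].
  by rewrite !map_poly0 !horner0 linear0 map_mx0 mulmx0 scale0r.
rewrite !rmorphD !rmorphM /= !map_polyX !map_polyC /= !hornerE linearD /= map_mxD mulmxDr.
rewrite mult_mxM map_mxM mulmxA IHq -scalemxAl vr scalerA scalerDl; congr (_ + _).
rewrite -scaler_int linearZ /= mult_mx1 map_mxZ map_mx1 -scalemxAr mulmx1.
by rewrite rmorph_int.
Qed.

(** The trace is the sum of the complex eigenvalues of multiplication by x; these
    are roots of any integer polynomial vanishing at x, hence algebraic integers. *)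
Lemma trace_int (x : F) : x \in intp -> \tr (mult_mx x) \is a Num.int.
Proof.
move=> /intpP[q q1 qx]; pose M : 'M[algC]_n := map_mx ratr (mult_mx x).
have n0 : (0 < n)%N by rewrite adim_gt0.
have [s sE] := closed_field_poly_normal (char_poly M).
have sO r : r \in s -> r \in Aint.
  move=> rs; have /eigenvalueP[v vr v0] : eigenvalue M r.
    rewrite eigenvalue_root_char sE rootZ ?root_prod_XsubC //.
    by rewrite lead_coef_eq0 monic_neq0 ?char_poly_monic.
  apply: (@root_monic_Aint (map_poly intr q)); last first.
  - by apply/polyOverP => i; rewrite coef_map /= rpred_int.
  - exact: monic_map.
  apply/rootP; have := mult_mx_eigen q vr; rewrite (rootP qx) linear0 map_mx0 mulmx0.
  by move/esym/eqP; rewrite scaler_eq0 (negbTE v0) orbF => /eqP.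
have MO : char_poly M \is a polyOver Aint.
  rewrite sE (monicP (char_poly_monic _)) scale1r big_seq rpred_prod // => r rs.
  by rewrite polyOverXsubC sO.
have : \tr M \in Aint.
  by rewrite -[\tr M]opprK -char_poly_trace // rpredN (polyOverP MO).
rewrite trace_map_mx => tO.
have : ratr (\tr (mult_mx x)) \is a @Num.int algC.
  by apply: Cint_rat_Aint => //; exact: Crat_rat.
case/intrP => z; rewrite -(rmorph_int (ratr : rat -> algC)) => /fmorph_inj ->.
exact: intr_int.
Qed.

Lemma rat_mx_denominator m p (A : 'M[rat]_(m, p)) :
  exists (d : int) (B : 'M[int]_(m, p)), d != 0 /\ map_mx intr B = d%:~R *: A.
Proof.
pose d := \prod_(ij : 'I_m * 'I_p) denq (A ij.1 ij.2).
exists d, (\matrix_(i, j) numq (d%:~R * A i j)); split.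
  by apply/prodf_neq0 => ij _; rewrite denq_neq0.
apply/matrixP => i j; rewrite !mxE numqK //.
rewrite /d (bigD1 (i, j)) //= mulrC intrM mulrA -numqE -intrM; exact: intr_int.
Qed.

(** The lattice O is found inside the dual, for the trace form, of the lattice
    spanned by integral multiples f j of the rational basis: T sends x to the
    traces of the products x * f j. The rows of W are the coordinates of a
    Z-basis of O on the rational basis. *)
Lemma integral_basis : exists2 W : 'M[rat]_n, W \in unitmx &
  forall x, x \in intp <-> exists z : 'rV[int]_n, basis_coord x = map_mx intr z *m W.
Proof.
have /choice[m mP] (i : 'I_n) : exists m : int, m != 0 /\ m%:~R * e`_i \in intp.
  by have [m ? ?] := int_multiple e`_i; exists m.
pose f i := (m i)%:~R * e`_i.
pose T : 'M[rat]_n := \matrix_(i, j) \tr (mult_mx (e`_i * f j)).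
have TE x j : (basis_coord x *m T) 0 j = \tr (mult_mx (x * f j)).
  rewrite {2}[x]basis_coordE mulr_suml !linear_sum mxE; apply: eq_bigr => i _.
  by rewrite -scalerAl !linearZ !mxE.
(* the trace form is nondegenerate: the trace of x * x^-1 is the degree of F *)
have uT : T \in unitmx.
  rewrite unitmxE unitfE; apply/det0P => -[v v0 vT]; pose x := of_coord v.
  have x0 : x != 0.
    by apply: contra v0 => /eqP x0; rewrite -[v]of_coordK -/x x0 linear0.
  have trx y : \tr (mult_mx (x * y)) = 0.
    rewrite [y]basis_coordE mulr_sumr !linear_sum big1 // => i _.
    have := TE x i; rewrite of_coordK vT mxE -scalerAr !linearZ /f mulrCA mulrzl.
    rewrite -scaler_int !linearZ /= => /esym/eqP; rewrite mulf_eq0 intr_eq0.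
    by rewrite (negbTE (mP i).1) => /eqP ->; rewrite mulr0.
  have := trx x^-1; rewrite mulfV // mult_mx1 mxtrace1 => /eqP.
  by rewrite pnatr_eq0 gtn_eqF ?adim_gt0.
(* L is the image of O in Z^n, and d clears the denominators of S, so that d Z^n
   comes from integral combinations of the f j *)
pose L z := exists2 x, x \in intp & basis_coord x *m T = map_mx intr z.
have [d [S [d0 SE]]] := rat_mx_denominator (invmx T *m diag_mx (\row_i (m i)%:~R^-1)).
have Ld v : L (d *: v).
  exists (\sum_i ((v *m S) 0 i)%:~R * f i).
    by apply: rpred_sum => i _; rewrite rpredM ?rpred_int //; exact: (mP i).2.
  have -> : \sum_i ((v *m S) 0 i)%:~R * f i = of_coord (d%:~R *: (map_mx intr v *m invmx T)).
    apply: eq_bigr => i _; rewrite /f mulrA -intrM mulrzl -scaler_int; congr (_ *: _).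
    rewrite intrM; have -> : ((v *m S) 0 i)%:~R = (map_mx intr v *m map_mx intr S) 0 i :> rat.
      by rewrite -map_mxM [RHS]mxE.
    rewrite SE -scalemxAr mulmxA mul_mx_diag !mxE -mulrA.
    by rewrite mulfVK // intr_eq0; exact: (mP i).1.
  by rewrite of_coordK -scalemxAl mulmxKV // map_mxZ.
have LB u v : L u -> L v -> L (u - v).
  move=> [x xO xE] [y yO yE]; exists (x - y); first exact: rpredB.
  by rewrite linearB mulmxBl xE yE map_mxB.
have [B B0 BE] := lattice_basis d0 Ld LB.
have uB : map_mx intr B \in @unitmx rat n by rewrite unitmxE det_map_mx unitfE intr_eq0.
exists (map_mx intr B *m invmx T); first by rewrite unitmx_mul uB unitmx_inv.
move=> x; split=> [xO|[z xE]].
  have /fin_all_exists[z zE] (j : 'I_n) : exists z : int, (basis_coord x *m T) 0 j = z%:~R.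
    by rewrite TE; apply/intrP/trace_int/rpredM => //; exact: (mP j).2.
  have xE : basis_coord x *m T = map_mx intr (\row_j z j).
    by apply/rowP => j; rewrite zE !mxE.
  have /BE[z' z'E] : L (\row_j z j) by exists x.
  by exists z'; rewrite mulmxA -map_mxM -z'E -xE mulmxK.
have [y yO yE] : L (z *m B) by apply/BE; exists z.
suff -> : x = y by [].
apply: (can_inj basis_coordK); apply: (can_inj (mulmxK uT)).
by rewrite yE xE map_mxM -!mulmxA mulVmx // mulmx1.
Qed.

End RingOfIntegers.

(** * Arithmetic in integral coordinates *)

Section IntegralCoordinates.
Variables (F : fieldExtType rat) (W : 'M[rat]_(\dim {:F})).
Local Notation n := (\dim {:F}).
Local Notation intp := (@intp F).
Hypothesis uW : W \in unitmx.
Hypothesis intW : forall x : F, x \in intp <->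
  exists z : 'rV[int]_n, basis_coord x = map_mx intr z *m W.

(** Coordinates of an element of F on the integral basis given by W. *)
Definition icoord (x : F) : 'rV[rat]_n := basis_coord x *m invmx W.
(** The element of F with given coordinates on the integral basis. *)
Definition of_icoord (v : 'rV[rat]_n) : F := of_coord (v *m W).
(** The matrix of multiplication by x on the integral basis, acting on rows. *)
Definition imult_mx (x : F) : 'M[rat]_n := W *m mult_mx x *m invmx W.

Lemma icoordK : cancel icoord of_icoord.
Proof. by move=> x; rewrite /of_icoord /icoord mulmxKV // basis_coordK. Qed.

Lemma of_icoordK : cancel of_icoord icoord.
Proof. by move=> v; rewrite /of_icoord /icoord of_coordK mulmxK. Qed.

Lemma icoord_is_linear : linear icoord.
Proof. by move=> a x y; rewrite /icoord linearP mulmxDl scalemxAl. Qed.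
HB.instance Definition _ :=
  GRing.isLinear.Build rat F 'rV[rat]_n _ icoord icoord_is_linear.

Lemma icoord_intP (x : F) : x \in intp <-> exists z : 'rV[int]_n, icoord x = map_mx intr z.
Proof.
rewrite intW; split=> -[z zE]; exists z; first by rewrite /icoord zE mulmxK.
by rewrite -zE /icoord mulmxKV.
Qed.

Lemma of_icoord_int (z : 'rV[int]_n) : of_icoord (map_mx intr z) \in intp.
Proof. by apply/icoord_intP; exists z; rewrite of_icoordK. Qed.

Lemma icoordM (x y : F) : icoord (x * y) = icoord x *m imult_mx y.
Proof. by rewrite /icoord /imult_mx !mulmxA mulmxKV // basis_coord_mul. Qed.

Lemma icoord_intM (z : int) (x : F) : icoord (z%:~R * x) = z%:~R *: icoord x.
Proof. by rewrite mulrzl -scaler_int linearZ. Qed.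

Lemma imult_mxM (x y : F) : imult_mx (x * y) = imult_mx x *m imult_mx y.
Proof. by rewrite /imult_mx mult_mxM !mulmxA mulmxKV. Qed.

Lemma imult_mx1 : imult_mx 1 = 1%:M.
Proof. by rewrite /imult_mx mult_mx1 mulmx1 mulmxV. Qed.

Lemma imult_mx_int (x : F) : x \in intp ->
  exists N : 'M[int]_n, imult_mx x = map_mx intr N.
Proof.
move=> xO; have /fin_all_exists[z zE] (i : 'I_n) :
    exists z : 'rV[int]_n, row i (imult_mx x) = map_mx intr z.
  have : of_icoord (map_mx intr (delta_mx 0 i : 'rV[int]_n)) * x \in intp.
    by rewrite rpredM // of_icoord_int.
  move=> /icoord_intP[z zE]; exists z; rewrite -zE icoordM of_icoordK map_delta_mx.
  by rewrite rowE.
exists (\matrix_i z i); apply/row_matrixP => i; rewrite zE.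
by apply/rowP => j; rewrite !mxE.
Qed.

(** The norm of an integral element x is x times an integral element, read off the
    adjugate matrix. *)
Lemma int_norm (x : F) (N : 'M[int]_n) : imult_mx x = map_mx intr N ->
  exists2 y, y \in intp & (\det N)%:~R = x * y.
Proof.
move=> xN; have /icoord_intP[z1 z1E] := rpred1 intp.
exists (of_icoord (map_mx intr (z1 *m \adj N))); first exact: of_icoord_int.
apply: (can_inj icoordK); rewrite mulrC icoordM of_icoordK xN -map_mxM -mulmxA.
rewrite mul_adj_mx mul_mx_scalar map_mxZ -z1E -icoord_intM mulr1 //.
Qed.

Lemma intp_dvd_nat (x : F) : x \in intp -> x != 0 ->
  exists2 m : nat, (1 < m)%N & exists2 y, y \in intp & m%:R = x * y.
Proof.
move=> xO x0; have [N xN] := imult_mx_int xO; have [y yO xy] := int_norm xN.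
have N0 : \det N != 0.
  rewrite -(intr_eq0 rat) -det_map_mx -xN -unitfE -unitmxE.
  have : imult_mx x *m imult_mx x^-1 = 1%:M by rewrite -imult_mxM mulfV // imult_mx1.
  by move=> /mulmx1_unit[].
(* the factor 2 ensures that the integer is greater than 1 *)
exists (2 * `|\det N|)%N; first by rewrite leq_pmulr // absz_gt0.
exists (2 * (sgz (\det N))%:~R * y); first by rewrite !rpredM ?rpred_int ?rpred_nat.
have -> : (2 * `|\det N|)%:R = 2 * ((sgz (\det N))%:~R * (\det N)%:~R) :> F.
  by rewrite natrM -intrM -abszEsg.
by rewrite xy !mulrA; congr (_ * y); rewrite mulrC !mulrA.
Qed.

(** The norm of 1 + D r is congruent to 1 modulo D. *)
Lemma intp_coprime_nat (D : nat) (r : F) : (1 < D)%N -> r \in intp ->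
  exists k : nat, coprime k D /\ exists2 y, y \in intp & k%:R = (1 + D%:R * r) * y.
Proof.
move=> D1 rO; have [N rN] := imult_mx_int rO.
pose M := 1%:M + D%:Z *: N.
have ME : imult_mx (1 + D%:R * r) = map_mx intr M.
  rewrite /M map_mxD map_mx1 map_mxZ -rN -imult_mx1 /imult_mx.
  rewrite mulr_natl linearD linearMn /= mulmxDr mulmxDl; congr (_ + _).
  by rewrite -scaler_nat -scalemxAr -scalemxAl.
have [y yO yE] := int_norm ME.
exists `|\det M|%N; split; last first.
  exists ((sgz (\det M))%:~R * y); first by rewrite rpredM ?rpred_int.
  by rewrite mulrCA -yE -intrM -abszEsg.
(* M is the identity matrix modulo D *)
have M1 : (\det M)%:~R = 1 :> 'Z_D.
  rewrite -det_map_mx; suff -> : map_mx intr M = 1%:M :> 'M['Z_D]_n by rewrite det1.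
  rewrite /M map_mxD map_mx1 map_mxZ /= -[D%:~R]/(D%:R) pchar_Zp //.
  by rewrite scale0r addr0.
rewrite coprime_sym -unitZpE // pmulrn abszEsg intrM M1 mulr1.
suff -> : sgz (\det M) = (-1) ^+ (\det M < 0)%R by rewrite rmorph_sign unitrX // unitrN1.
have M0 : \det M != 0 by apply: contra_eq_neq M1 => ->; rewrite eq_sym oner_eq0.
by rewrite -[LHS]mulr1; case: sgzP M0; rewrite ?eqxx.
Qed.

(** O / D O is finite, so two terms of a sequence in O are congruent modulo D. *)
Lemma intp_mod_finite (D : nat) (f : nat -> F) : (0 < D)%N ->
    (forall i, f i \in intp) ->
  exists i j : nat, (i < j)%N /\ exists2 y, y \in intp & f j - f i = D%:R * y.
Proof.
move=> D0 fO.
have dD : \det (D%:Z%:M : 'M[int]_n) != 0 by rewrite det_scalar expf_neq0 // -lt0n.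
have [T [r [_ _ rT]]] := lattice_index dD.
have /choice[t tE] (i : nat) : exists t : T, exists2 y,
    y \in intp & f i - of_icoord (map_mx intr (r t)) = D%:R * y.
  have /icoord_intP[v vE] := fO i; have [t [z zE]] := rT v; exists t.
  exists (of_icoord (map_mx intr z)); first exact: of_icoord_int.
  apply: (can_inj icoordK); rewrite linearB /= of_icoordK vE -map_mxB zE.
  rewrite -[D%:R]/(D%:~R) icoord_intM of_icoordK -map_mxZ mul_mx_scalar //.
pose g (i : 'I_#|T|.+1) := t i.
have /injectivePn[i [j ij gij]] : ~~ injectiveb g.
  apply/negP => /injectiveP/leq_card; by rewrite card_ord ltnn.
wlog lt_ij : i j ij gij / (i < j)%N.
  move=> th; have [lij|lji|eij] := ltngtP i j; first exact: (th i j).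
    by apply: (th j i) => //; rewrite eq_sym.
  by case/eqP: ij; apply: val_inj.
exists i, j; split=> //; have [y yO yE] := tE i; have [y' yO' yE'] := tE j.
exists (y' - y); first exact: rpredB.
move: gij; rewrite /g mulrBr -yE -yE' => ->.
by rewrite opprB addrA subrK.
Qed.

(** Some positive power of s is idempotent modulo D. *)
Lemma intp_idempotent_power (D : nat) (s : F) : (0 < D)%N -> s \in intp ->
  exists (m : nat) (y : F), y \in intp /\ s ^+ m.+1 * (1 - s ^+ m.+1) = D%:R * y.
Proof.
move=> D0 sO; have [i [j [ij [y yO yE]]]] :=
  intp_mod_finite D0 (fun i => rpredX i sO : s ^+ i \in intp).
pose cg a b := exists2 y, y \in intp & a - b = D%:R * y.
have cgM a b c : c \in intp -> cg a b -> cg (c * a) (c * b).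
  by move=> cO [z zO zE]; exists (c * z); [exact: rpredM | rewrite -mulrBr zE mulrCA].
have cgT a b c : cg a b -> cg b c -> cg a c.
  move=> [z zO zE] [z' zO' zE']; exists (z + z'); first exact: rpredD.
  by rewrite mulrDr -zE -zE' addrA subrK.
pose p := (j - i)%N; have p0 : (0 < p)%N by rewrite subn_gt0.
have cgp a k : (i <= a)%N -> cg (s ^+ (a + k * p)) (s ^+ a).
  move=> ia; elim: k => [|k IHk]; first by exists 0; rewrite ?rpred0 // addn0 subrr mulr0.
  have [l lE] : exists l, (a + k * p = l + i)%N.
    by exists (a + k * p - i)%N; rewrite subnK // (leq_trans ia) // leq_addr.
  have lE' : (a + k.+1 * p = l + j)%N by rewrite mulSn addnCA lE addnCA subnK // ltnW.
  apply: cgT IHk; rewrite lE' lE !exprD; apply: cgM; last by exists y.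
  exact: rpredX.
(* any multiple of the period p that is at least i works *)
pose m := (i.+1 * p).-1; have mE : m.+1 = (i.+1 * p)%N by rewrite prednK // muln_gt0.
have [|z zO zE] := cgp m.+1 i.+1.
  by rewrite mE (leq_trans (leqnSn i)) // leq_pmulr.
exists m, (- z); split; first by rewrite rpredN.
by rewrite mulrN -zE -mE exprD mulrBr mulr1 opprB.
Qed.

(** At the primes dividing D, the ideal (g, y) is generated by one element g'.
    With x = y / g and 1 = s + x t as above, and an idempotent e modulo D which
    is a power of s, put g' = (e + (1 - e) x) g. Modulo D, the element s is
    invertible on the part e = 1, and x t = 1 - s is invertible on the part
    e = 0, where s is nilpotent; hence (e + (1 - e) x) (e s + (1 - e) t), which
    is e s + (1 - e) x t modulo D, is invertible modulo D. *)
Lemma intp_local_gcd (D : nat) (g y : F) : (1 < D)%N -> g != 0 ->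
  exists a b g' : F, [/\ a \in intp, b \in intp, g' = a * g + b * y, g' != 0 &
   exists k : nat, [/\ coprime k D, exists2 u, u \in intp & k%:R * g = g' * u &
                      exists2 v, v \in intp & k%:R * y = g' * v]].
Proof.
move=> D1 g0; pose x := y / g; have yE : y = x * g by rewrite divfK.
have [s [t [[sO xsO] [tO xtO] st]]] := ideal_mul_inv1 x.
have [m [y0 [y0O y0E]]] := intp_idempotent_power (ltnW D1) sO.
set e := s ^+ m.+1 in y0E; pose P := s ^+ m; pose S := \sum_(i < m.+1) s ^+ i.
have sP : s * P = e by rewrite /P -exprS.
have sS : (1 - s) * S = 1 - e.
  by rewrite -[RHS]opprB subrX1 -mulNr opprB.
have eO : e \in intp by rewrite rpredX.
have PO : P \in intp by rewrite rpredX.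
have SO : S \in intp by apply: rpred_sum => i _; rewrite rpredX.
pose c := e + (1 - e) * x; pose f := e * s + (1 - e) * t; pose w := e * P + (1 - e) * S.
pose e1 := y0 * (t + x * s - s - x * t); pose e2 := y0 * (s * S + (1 - s) * P - 3).
have xt : x * t = 1 - s by rewrite st addrAC subrr add0r.
(* w is the inverse of c * f modulo D: sP and sS invert s and 1 - s on the two
   parts of the decomposition by e *)
have cf : c * f = (e * s + (1 - e) * (1 - s)) + D%:R * e1.
  rewrite /e1 mulrA -y0E -xt /c /f; ring.
have Aw : (e * s + (1 - e) * (1 - s)) * w = 1 + D%:R * e2.
  have -> : (e * s + (1 - e) * (1 - s)) * w = e * e * (s * P) +
     (1 - e) * (1 - e) * ((1 - s) * S) + e * (1 - e) * (s * S + (1 - s) * P).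
    by rewrite /w; ring.
  rewrite sP sS /e2 mulrA -y0E; ring.
pose r := e2 + e1 * w.
have eCO : 1 - e \in intp by rewrite rpredB ?rpred1.
have wO : w \in intp by rewrite rpredD ?rpredM.
have fO : f \in intp by rewrite rpredD ?rpredM.
have rO : r \in intp.
  have sCO : 1 - s \in intp by rewrite rpredB ?rpred1.
  have O3 : 3 \in intp by rewrite rpred_nat.
  apply: rpredD.
    by apply: rpredM => //; apply: rpredB => //; apply: rpredD; apply: rpredM.
  apply: rpredM => //; apply: rpredM => //; apply: rpredB => //.
  by apply: rpredB => //; apply: rpredD.
have cfw : c * f * w = 1 + D%:R * r by rewrite cf mulrDl Aw /r; ring.
have [k [kD [y1 y1O kE]]] := intp_coprime_nat D1 rO.
rewrite -cfw in kE.
have k0 : k%:R != 0 :> F.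
  rewrite -[k%:R]/(k%:~R) intrF_eq0; apply: contraTneq kD => -[->].
  by rewrite /coprime gcd0n; case: (D) D1 => [|[]].
have c0 : c != 0 by apply: contraNneq k0 => c0; rewrite kE c0 !mul0r.
exists e, (1 - e), (c * g); split=> //.
- by rewrite yE /c; ring.
- exact: mulf_neq0.
exists k; split=> //.
  by exists (f * w * y1); [rewrite !rpredM | rewrite kE; ring].
exists (x * f * w * y1); last by rewrite kE yE; ring.
have xfO : x * f \in intp.
  by rewrite /f mulrDr mulrCA [x * (_ * t)]mulrCA; apply: rpredD; apply: rpredM.
by apply: rpredM => //; apply: rpredM.
Qed.

(** * Ideals *)

Lemma intr_mx_inj m p : injective (map_mx intr : 'M[int]_(m, p) -> 'M[rat]_(m, p)).
Proof.
move=> A B /matrixP AB; apply/matrixP => i j; have := AB i j.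
by rewrite [LHS]mxE [RHS]mxE => /intr_inj.
Qed.

Section Ideal.
Variable I : set F.
Hypothesis nzI : nonzero_ideals F I.

Lemma ideal_sub x : I x -> x \in intp.
Proof. by move=> Ix; case: nzI => -[/(_ x Ix) xO _ _ _] _; exact/intpP. Qed.

Lemma idealD x y : I x -> I y -> I (x + y).
Proof. by case: nzI => -[_ _ ID _] _; exact: ID. Qed.

Lemma idealM a x : a \in intp -> I x -> I (a * x).
Proof. by case: nzI => -[_ _ _ IM] _ /intpP; exact: IM. Qed.

Lemma idealB x y : I x -> I y -> I (x - y).
Proof.
move=> Ix Iy; apply: idealD => //; rewrite -mulN1r; apply: idealM => //.
by rewrite rpredN rpred1.
Qed.

(** A nonzero ideal contains an integer m > 1. *)
Lemma ideal_nat : exists2 m : nat, (1 < m)%N & I m%:R.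
Proof.
have [_ [x Ix x0]] := nzI.
have [m m1 [y yO xy]] := intp_dvd_nat (ideal_sub Ix) x0.
by exists m => //; rewrite xy mulrC; exact: idealM.
Qed.

Lemma ideal_lattice : exists2 B : 'M[int]_n, \det B != 0 &
  forall x, I x <-> exists z : 'rV[int]_n, icoord x = map_mx intr (z *m B).
Proof.
have [m m1 Im] := ideal_nat.
pose L (z : 'rV[int]_n) := I (of_icoord (map_mx intr z)).
have lift z : icoord (of_icoord (map_mx intr z)) = map_mx intr (z : 'rV[int]_n).
  exact: of_icoordK.
have Ld z : L (m%:Z *: z).
  rewrite /L; suff -> : of_icoord (map_mx intr (m%:Z *: z)) = of_icoord (map_mx intr z) * m%:R.
    by apply: idealM => //; exact: of_icoord_int.
  apply: (can_inj icoordK); rewrite lift mulrC -[m%:R]/(m%:Z%:~R) icoord_intM lift.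
  exact: map_mxZ.
have LB u v : L u -> L v -> L (u - v).
  move=> Lu Lv; rewrite /L [of_icoord _](_ : _ =
    of_icoord (map_mx intr u) - of_icoord (map_mx intr v)); first exact: idealB.
  by apply: (can_inj icoordK); rewrite linearB /= !lift map_mxB.
have m0 : m%:Z != 0 by rewrite eqz_nat -lt0n ltnW.
have [B B0 BE] := lattice_basis m0 Ld LB; exists B => // x; split=> [Ix|[z xE]].
  have /icoord_intP[v vE] := ideal_sub Ix.
  have /BE[z vz] : L v by rewrite /L -vE icoordK.
  by exists z; rewrite vE vz.
have : L (z *m B) by apply/BE; exists z.
by rewrite /L -xE icoordK.
Qed.

Lemma ideal_norm_det (B : 'M[int]_n) : \det B != 0 ->
    (forall x, I x <-> exists z : 'rV[int]_n, icoord x = map_mx intr (z *m B)) ->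
  ideal_norm I = `|\det B|%N.
Proof.
move=> B0 BE; have [T [r [cT r_inj r_surj]]] := lattice_index B0.
pose x t := of_icoord (map_mx intr (r t)); pose c (y : F) := [set y + z | z in I].
have ceq y y' : c y = c y' <-> I (y - y').
  split=> [yy'|Iyy'].
    have : c y' y by rewrite -yy'; exists 0; rewrite ?addr0 //; case: nzI => -[].
    by case=> z Iz <-; rewrite addrAC subrr add0r.
  apply/seteqP; split=> _ [z Iz <-].
    by exists (y - y' + z); [exact: idealD | rewrite addrA [y' + _]addrC subrK].
  exists (- (y - y') + z); last by rewrite opprB addrA [y + _]addrC subrK.
  by rewrite addrC; exact: idealB.
have IxB y v t : icoord y = map_mx intr v ->
    I (y - x t) <-> exists z : 'rV[int]_n, v - r t = z *m B.
  move=> yv; rewrite BE; split=> -[z zE]; exists z; move: zE;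
    rewrite linearB /= of_icoordK yv -map_mxB.
    exact: intr_mx_inj.
  by move=> ->.
pose f (i : 'I_#|T|) := c (x (enum_val i)).
have -> : ideal_norm I = #|` fset_set (f @` setT)|.
  congr #|` fset_set _|; apply/seteqP; split=> [_ [y /intpP yO <-]|_ [i _ <-]].
    have /icoord_intP[v vE] := yO; have [t /(IxB _ _ t vE) yt] := r_surj v.
    by exists (enum_rank t) => //; rewrite /f enum_rankK; apply/esym/ceq.
  by exists (x (enum_val i)) => //; apply/intpP; exact: of_icoord_int.
rewrite -cT; apply: card_fset_set.
rewrite (card_eqr card_II); apply: inj_card_eq => i j _ _ /ceq.
move/(IxB _ (r (enum_val i))) => [|z zE]; first exact: of_icoordK.
exact/enum_val_inj/(r_inj _ _ _ zE).
Qed.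

(** At the primes dividing D, a nonzero ideal is generated by one element g. *)
Lemma ideal_local_generator (D : nat) : (1 < D)%N ->
  exists g, [/\ I g, g != 0 & exists2 k : nat, coprime k D &
     forall y, I y -> exists2 u, u \in intp & k%:R * y = g * u].
Proof.
move=> D1; have [B B0 BE] := ideal_lattice.
have gen (s : seq F) : (forall y, y \in s -> I y) ->
    exists g, [/\ I g, g != 0 & exists2 k : nat, coprime k D &
     forall y, y \in s -> exists2 u, u \in intp & k%:R * y = g * u].
  elim: s => [|y s IHs] Is.
    have [_ [x Ix x0]] := nzI; exists x; split=> //; exists 1%N => //.
    exact: coprime1n.
  have [z zs|g [Ig g0 [k kD gP]]] := IHs; first by apply: Is; rewrite inE zs orbT.
  have [a [b [g' [aO bO g'E g'0 [l [lD [u uO uE] [v vO vE]]]]]]] := intp_local_gcd y D1 g0.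
  exists g'; split=> //.
    by rewrite g'E; apply: idealD; apply: idealM => //; apply: Is; rewrite mem_head.
  exists (k * l)%N; first by rewrite coprimeMl kD.
  move=> z; rewrite inE => /orP[/eqP -> |/gP[w wO wE]].
    exists (k%:R * v); first by rewrite rpredM ?rpred_nat.
    by rewrite natrM -mulrA vE mulrCA.
  exists (u * w); first exact: rpredM.
  by rewrite natrM mulrAC wE mulrC [_ * (g * w)]mulrA uE mulrA.
pose s := [seq of_icoord (map_mx intr (row i B)) | i <- enum 'I_n].
have [_ /mapP[i _ ->]|g [Ig g0 [k kD gP]]] := gen s.
  by apply/BE; exists (delta_mx 0 i); rewrite of_icoordK -rowE.
exists g; split=> //; exists k => // y /BE[z zE].
have yE : y = \sum_i (z 0 i)%:~R * of_icoord (map_mx intr (row i B)).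
  apply: (can_inj icoordK); rewrite zE mulmx_sum_row !raddf_sum; apply: eq_bigr => i _.
  by rewrite /= icoord_intM of_icoordK map_mxZ.
have /choice[u uP] (i : 'I_n) : exists u : F, u \in intp /\
    k%:R * of_icoord (map_mx intr (row i B)) = g * u.
  have [|u uO uE] := gP (of_icoord (map_mx intr (row i B))); last by exists u.
  by apply/mapP; exists i => //; rewrite mem_enum.
exists (\sum_i (z 0 i)%:~R * u i).
  by apply: rpred_sum => i _; rewrite rpredM ?rpred_int //; case: (uP i).
rewrite yE !mulr_sumr; apply: eq_bigr => i _.
by rewrite mulrCA (uP i).2 mulrCA.
Qed.

End Ideal.

(** * The finite adeles of F in integral coordinates *)

Local Notation AF := (adeleF F).
Local Notation "M ^a" := (map_mx adele_rat M) (at level 2, format "M ^a").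

(** Coordinates of a finite adele of F on the integral basis. *)
Definition acoord (g : AF) : 'rV[adele]_n := g *m (invmx W)^a.
(** The finite adele of F with given coordinates on the integral basis. *)
Definition of_acoord (v : 'rV[adele]_n) : AF := v *m W^a.
(** The matrix of multiplication by g on the integral basis, acting on rows. *)
Definition amult_mx (g : AF) : 'M[adele]_n := W^a *m adele_mult_mx g *m (invmx W)^a.
(** The embedding of F in its finite adeles. *)
Definition emb (x : F) : AF := pure_tensor x 1.

Lemma acoordK : cancel acoord of_acoord.
Proof.
by move=> g; rewrite /of_acoord /acoord -mulmxA -map_mxM mulVmx // map_mx1 mulmx1.
Qed.

Lemma of_acoordK : cancel of_acoord acoord.
Proof.
by move=> g; rewrite /of_acoord /acoord -mulmxA -map_mxM mulmxV // map_mx1 mulmx1.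
Qed.

Lemma acoordD (g h : AF) : acoord (g + h) = acoord g + acoord h.
Proof. exact: mulmxDl. Qed.

Lemma acoordB (g h : AF) : acoord (g - h) = acoord g - acoord h.
Proof. exact: mulmxBl. Qed.

Lemma acoordZ (a : adele) (g : AF) : acoord (a *: g) = a *: acoord g.
Proof. by rewrite /acoord -scalemxAl. Qed.

Lemma acoord_sum (J : finType) (g : J -> AF) :
  acoord (\sum_i g i) = \sum_i acoord (g i).
Proof. by rewrite /acoord mulmx_suml. Qed.

Lemma acoord_pure (x : F) (a : adele) : acoord (pure_tensor x a) = a *: (icoord x)^a.
Proof. by rewrite /acoord /pure_tensor -scalemxAl -map_mxM. Qed.

Lemma acoord_emb (x : F) : acoord (emb x) = (icoord x)^a.
Proof. by rewrite acoord_pure scale1r. Qed.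

Lemma scaleAF (a : adele) (g h : AF) : a *: (g * h) = (a *: g) * h.
Proof. exact: scalemxAl. Qed.

Lemma scaleAFr (a : adele) (g h : AF) : a *: (g * h) = g * (a *: h).
Proof. by rewrite mulrC scaleAF mulrC. Qed.

Lemma emb1 : emb 1 = 1 :> AF. Proof. by []. Qed.

Lemma pure_emb (x : F) (a : adele) : pure_tensor x a = a *: emb x.
Proof. by rewrite /emb /pure_tensor scalerA mulr1. Qed.

Lemma embM (x y : F) : emb (x * y) = emb x * emb y.
Proof. by rewrite [RHS]adeleF_mul_pure mulr1. Qed.

Lemma embB (x y : F) : emb (x - y) = emb x - emb y.
Proof. by apply: (can_inj acoordK); rewrite acoordB !acoord_emb linearB map_mxB. Qed.

Lemma emb_nat (m : nat) : emb m%:R = (m%:R : adele) *: (1 : AF).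
Proof.
apply: (can_inj acoordK); rewrite acoordZ -emb1 !acoord_emb -[m%:R]mulr1.
by rewrite -[m%:R]/(m%:Z%:~R) icoord_intM map_mxZ rmorph_int.
Qed.

Lemma acoordM (h g : AF) : acoord (h * g) = acoord h *m amult_mx g.
Proof.
rewrite /acoord /amult_mx [h * g]/(h *m adele_mult_mx g) -!mulmxA; congr (_ *m _).
by rewrite !mulmxA -map_mxM mulVmx // map_mx1 mul1mx.
Qed.

Lemma amult_mxD (g h : AF) : amult_mx (g + h) = amult_mx g + amult_mx h.
Proof. by rewrite /amult_mx adele_mult_mxD mulmxDr mulmxDl. Qed.

Lemma amult_mx_pure (x : F) (a : adele) :
  amult_mx (pure_tensor x a) = a *: (imult_mx x)^a.
Proof.
by rewrite /amult_mx adele_mult_mx_pure -scalemxAr -scalemxAl -!map_mxM.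
Qed.

Lemma det_amult_mx (g : AF) : \det (amult_mx g) = \det (adele_mult_mx g).
Proof.
rewrite /amult_mx !det_mulmx mulrAC -det_mulmx -map_mxM mulmxV // map_mx1.
by rewrite det1 mul1r.
Qed.

Lemma OhatP (g : AF) : Ohat F g <-> (forall j, acoord g 0 j \in zhatp).
Proof.
split=> [[m [x [a [xO az ->]]]] j|gz].
  rewrite acoord_sum summxE; apply: rpred_sum => i _.
  have /intpP/icoord_intP[z zE] := xO i.
  rewrite acoord_pure zE !mxE rpredM ?zhat_intr //; exact/zhatP/az.
exists n, (fun i => of_icoord (map_mx intr (delta_mx 0 i : 'rV[int]_n))),
  (fun i => acoord g 0 i).
split=> [i|i|]; first exact/intpP/of_icoord_int.
  exact/zhatP/gz.
apply: (can_inj acoordK); rewrite acoord_sum [LHS]row_sum_delta.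
apply: eq_bigr => i _; rewrite acoord_pure of_icoordK; congr (_ *: _).
by rewrite !map_delta_mx.
Qed.

Lemma amult_mx_zhat (g : AF) : Ohat F g -> forall i j, amult_mx g i j \in zhatp.
Proof.
move=> [m [x [a [xO az ->]]]] i j.
elim/big_ind: _ => [|g1 g2 g1z g2z|k _].
- rewrite /amult_mx /adele_mult_mx big1 ?mulmx0 ?mul0mx ?mxE ?rpred0 // => k _.
  by rewrite mxE scale0r.
- by rewrite amult_mxD mxE rpredD.
have [N NE] := imult_mx_int (introT (intpP _) (xO k)).
rewrite amult_mx_pure NE !mxE rpredM ?zhat_intr //; exact/zhatP/az.
Qed.

Lemma OhatB (g h : AF) : Ohat F g -> Ohat F h -> Ohat F (g - h).
Proof.
move=> /OhatP gz /OhatP hz; apply/OhatP => j; rewrite acoordB.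
by move: (acoord g) (acoord h) gz hz => u v uz vz; rewrite !mxE rpredB.
Qed.

Lemma OhatM (g h : AF) : Ohat F g -> Ohat F h -> Ohat F (g * h).
Proof.
move=> /OhatP gz /amult_mx_zhat hz; apply/OhatP => j; rewrite acoordM mxE.
by apply: rpred_sum => i _; rewrite rpredM.
Qed.

Lemma OhatZ a (g : AF) : a \in zhatp -> Ohat F g -> Ohat F (a *: g).
Proof. by move=> az /OhatP gz; apply/OhatP => j; rewrite acoordZ mxE rpredM. Qed.

Lemma Ohat_sum (J : finType) (g : J -> AF) :
  (forall i, Ohat F (g i)) -> Ohat F (\sum_i g i).
Proof.
move=> gz; apply/OhatP => j; rewrite acoord_sum summxE; apply: rpred_sum => i _.
exact: (proj1 (OhatP _) (gz i)).
Qed.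

Lemma OhatD (g h : AF) : Ohat F g -> Ohat F h -> Ohat F (g + h).
Proof.
by move=> /OhatP gz /OhatP hz; apply/OhatP => j; rewrite acoordD mxE rpredD.
Qed.

(** A rational vector in the profinite completion of a full integer lattice
    lies in that lattice. *)
Lemma lattice_emb (B : 'M[int]_n) (x : F) (c : 'rV[adele]_n) : \det B != 0 ->
    (forall j, c 0 j \in zhatp) -> acoord (emb x) = c *m (map_mx intr B)^a ->
  exists z : 'rV[int]_n, icoord x = map_mx intr (z *m B).
Proof.
move=> B0 cz; have uB : map_mx intr B \in @unitmx rat n.
  by rewrite unitmxE det_map_mx unitfE intr_eq0.
rewrite acoord_emb => xc.
have cE : c = (icoord x *m invmx (map_mx intr B))^a.
  by rewrite map_mxM xc -mulmxA -map_mxM mulmxV // map_mx1 mulmx1.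
have /fin_all_exists[z zE] (j : 'I_n) : exists z : int,
    (icoord x *m invmx (map_mx intr B)) 0 j = z%:~R.
  by apply/intrP/zhat_rat; have := cz j; rewrite cE [X in X \in _]mxE.
exists (\row_j z j); rewrite map_mxM.
have -> : map_mx intr (\row_j z j) = icoord x *m invmx (map_mx intr B).
  by apply/rowP => j; rewrite zE !mxE.
by rewrite mulmxKV.
Qed.

Lemma Ohat_emb (x : F) : Ohat F (emb x) <-> x \in intp.
Proof.
split=> [/OhatP xz|/icoord_intP[z zE]]; last first.
  by apply/OhatP => j; rewrite acoord_emb zE !mxE zhat_intr.
have [||z zE] := @lattice_emb 1%:M x _ _ xz; first by rewrite det1 oner_eq0.
  by rewrite !map_mx1 mulmx1.
by apply/icoord_intP; exists z; rewrite zE mulmx1.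
Qed.

Lemma Ohat1 : Ohat F (1 : AF).
Proof. by rewrite -emb1; apply/Ohat_emb; exact: rpred1. Qed.

Lemma adeleF_denominator (g : AF) :
  exists2 m : nat, (0 < m)%N & Ohat F ((m%:R : adele) *: g).
Proof.
have /fin_all_exists[m mP] (j : 'I_n) : exists m : nat,
    (0 < m)%N /\ m%:R * acoord g 0 j \in zhatp.
  by have [m ? ?] := adele_denominator (acoord g 0 j); exists m.
exists (\prod_j m j)%N; first by apply: prodn_gt0 => j; case: (mP j).
apply/OhatP => j; rewrite acoordZ mxE (bigD1 j) //= mulnC natrM -mulrA.
by rewrite rpredM ?rpred_nat //; case: (mP j).
Qed.

(** * The ideal of an integral idele *)

(** The ideal I(g) of the elements of F that lie in g \hat{O}. *)
Definition ideal_of (g : AF) : set F :=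
  [set x | exists2 h, Ohat F h & emb x = g * h].

Lemma sym_fE : sym_f F = Ohat F `&` [set g : AF | g \is a GRing.unit].
Proof.
have phi_inj (g h : AF) : bc_phi g = bc_phi h -> g = h.
  by move=> gh; rewrite -[g]mul1r -[h]mul1r; rewrite /bc_phi in gh;
     rewrite [LHS]/(_ *m adele_mult_mx g) gh.
apply/seteqP; split=> [g [ug [h hO /phi_inj hg]]|g [gO ug]].
  by rewrite -hg in ug *; split.
by split=> //; exists g.
Qed.

Lemma sym_fP (g : AF) : sym_f F g <-> Ohat F g /\ g \is a GRing.unit.
Proof. by rewrite sym_fE. Qed.

Lemma emb0 : emb 0 = 0 :> AF.
Proof. by rewrite -(subrr 0) embB subrr. Qed.

Lemma embD (x y : F) : emb (x + y) = emb x + emb y.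
Proof.
have embN : emb (- y) = - emb y by rewrite -sub0r embB emb0 sub0r.
by rewrite -{1}[y]opprK embB embN opprK.
Qed.

Lemma Ohat0 : Ohat F (0 : AF).
Proof. by rewrite -(subrr (1 : AF)); apply: OhatB; exact: Ohat1. Qed.

Lemma ideal_of_nonzero (g : AF) : sym_f F g -> nonzero_ideals F (ideal_of g).
Proof.
move=> /sym_fP[gO ug]; split; first split.
- move=> x [h hO xE]; apply/intpP/Ohat_emb; rewrite xE; exact: OhatM.
- by exists 0; rewrite ?emb0 ?mulr0 //; exact: Ohat0.
- move=> x y [h hO xE] [k kO yE]; exists (h + k); first exact: OhatD.
  by rewrite embD xE yE mulrDr.
- move=> a x /intpP/Ohat_emb aO [h hO xE]; exists (emb a * h); first exact: OhatM.
  by rewrite embM xE mulrCA.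
have [m m0 mO] := adeleF_denominator g^-1.
exists m%:R; last by rewrite -[m%:R]/(m%:~R) intrF_eq0 eqz_nat -lt0n.
exists ((m%:R : adele) *: g^-1) => //.
by rewrite emb_nat -scaleAFr divrr.
Qed.

(** The adele k lies in g \hat{O} if and only if it lies in the \hat{Z}-module
    spanned by I(g). For the direct implication, k = y + m k' with y integral in
    F, k' in \hat{O} and m > 0 an integer in I(g); then y lies in I(g). *)
Lemma ideal_of_hat (g : AF) (B : 'M[int]_n) : sym_f F g -> \det B != 0 ->
    (forall x, ideal_of g x <-> exists z : 'rV[int]_n, icoord x = map_mx intr (z *m B)) ->
  forall k : AF, (exists2 h, Ohat F h & k = g * h) <->
    (exists2 c : 'rV[adele]_n, (forall j, c 0 j \in zhatp) &
        acoord k = c *m (map_mx intr B)^a).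
Proof.
move=> sg B0 BE k; have [gO ug] := proj1 (sym_fP g) sg; split; last first.
  move=> [c cz kE].
  have /fin_all_exists[h hP] (i : 'I_n) : exists h : AF,
      Ohat F h /\ emb (of_icoord (map_mx intr (row i B))) = g * h.
    have /BE[h hO hE] : exists z : 'rV[int]_n,
        icoord (of_icoord (map_mx intr (row i B))) = map_mx intr (z *m B).
      by exists (delta_mx 0 i); rewrite of_icoordK -rowE.
    by exists h.
  exists (\sum_i c 0 i *: h i).
    by apply: Ohat_sum => i; apply: OhatZ => //; case: (hP i).
  apply: (can_inj acoordK); rewrite kE mulr_sumr acoord_sum mulmx_sum_row.
  apply: eq_bigr => i _; rewrite -scaleAFr acoordZ -(hP i).2 acoord_emb of_icoordK.
  by rewrite -!map_row.
move=> [h hO kE].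
have kO : Ohat F k by rewrite kE; exact: OhatM.
have nzI := ideal_of_nonzero sg.
have [m m1 Im] := ideal_nat nzI; have [hm hmO hmE] := Im.
have /fin_all_exists[v /fin_all_exists[w vw]] (j : 'I_n) : exists (v : int) (w : adele),
    w \in zhatp /\ acoord k 0 j = v%:~R + m%:R * w.
  exact: (zhat_approx (ltnW m1) (proj1 (OhatP k) kO j)).
pose y := of_icoord (map_mx intr (\row_j v j)); pose k' := of_acoord (\row_j w j).
have k'O : Ohat F k'.
  by apply/OhatP => j; rewrite of_acoordK mxE; case: (vw j).
have kE' : acoord k = (map_mx intr (\row_j v j))^a + (m%:R : adele) *: \row_j w j.
  by apply/rowP => j; rewrite (vw j).2 !mxE rmorph_int.
(* k = y + m k', with y in F *)
have yE : emb y = k - (m%:R : adele) *: k'.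
  apply: (can_inj acoordK); rewrite acoordB acoordZ of_acoordK kE' acoord_emb.
  by rewrite of_icoordK addrK.
have /BE[z zE] : ideal_of g y.
  exists (h - hm * k'); first by apply: OhatB => //; exact: OhatM.
  by rewrite yE kE mulrBr mulrA -hmE emb_nat -scaleAF mul1r.
have /fin_all_exists[Z ZE] (j : 'I_n) : exists Z : 'rV[int]_n,
    m%:Z *: delta_mx 0 j = Z *m B.
  have /BE[Z ZE] : ideal_of g (m%:~R * of_icoord (map_mx intr (delta_mx 0 j : 'rV[int]_n))).
    rewrite mulrC; apply: idealM Im => //; exact: of_icoord_int.
  by exists Z; apply: intr_mx_inj; rewrite -ZE icoord_intM of_icoordK map_mxZ.
have mE : (m%:Z)%:M = (\matrix_j Z j) *m B.
  by apply/row_matrixP => j; rewrite row_mul rowK -ZE -scalemx1 linearZ /= row1.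
exists ((map_mx intr z)^a + (\row_j w j) *m (map_mx intr (\matrix_j Z j))^a).
  move=> j; rewrite mxE rpredD //; first by rewrite !mxE zhat_intr.
  rewrite mxE; apply: rpred_sum => i _; rewrite [X in _ * X]mxE [X in adele_rat X]mxE.
  by rewrite rpredM ?zhat_intr // mxE; case: (vw i).
rewrite mulmxDl -mulmxA -!map_mxM /= -mE -zE of_icoordK kE'; congr (_ + _).
rewrite !map_scalar_mx mul_mx_scalar; congr (_ *: _).
by rewrite /= rmorph_int.
Qed.

Lemma sym_f_unitsP (u : AF) : sym_f_units F u <->
  Ohat F u /\ exists2 v, Ohat F v & u * v = 1.
Proof.
split=> [[/sym_fP[uO _] [v /sym_fP[vO _] uv]]|[uO [v vO uv]]]; first by split=> //; exists v.
have unit (a b : AF) : a * b = 1 -> a \is a GRing.unit.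
  by move=> ab; apply/unitrP; exists b; rewrite mulrC ab.
split; first by apply/sym_fP; split=> //; exact: unit uv.
by exists v => //; apply/sym_fP; split=> //; apply: (unit _ u); rewrite mulrC.
Qed.

Lemma ideal_of_unit (u g : AF) : sym_f_units F u -> ideal_of (u * g) = ideal_of g.
Proof.
move=> /sym_f_unitsP[uO [v vO uv]]; apply/seteqP; split=> x [h hO xE].
  by exists (u * h); [exact: OhatM | rewrite xE mulrA (mulrC u)].
exists (v * h); first exact: OhatM.
by rewrite xE mulrAC mulrA uv mul1r mulrC.
Qed.

Lemma ideal_of_inj (g h : AF) : sym_f F g -> sym_f F h ->
  ideal_of g = ideal_of h -> exists2 u, sym_f_units F u & h = u * g.
Proof.
move=> sg sh gh; have [B B0 BE] := ideal_lattice (ideal_of_nonzero sg).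
have gP := ideal_of_hat sg B0 BE; rewrite gh in BE; have hP := ideal_of_hat sh B0 BE.
have [u uO uE] : exists2 u, Ohat F u & h = g * u.
  by apply/gP/hP; exists 1; rewrite ?mulr1 //; exact: Ohat1.
have [v vO vE] : exists2 v, Ohat F v & g = h * v.
  by apply/hP/gP; exists 1; rewrite ?mulr1 //; exact: Ohat1.
exists u; last by rewrite mulrC.
apply/sym_f_unitsP; split=> //; exists v => //.
have [_ ug] := proj1 (sym_fP g) sg; apply: (mulrI ug).
by rewrite mulr1 mulrA -uE -vE.
Qed.

(** * Determinants and norms *)

(** The defining condition of [det_phi] determines q, as 1 is the only positive
    rational number that is a unit of \hat{Z}. *)
Lemma det_phi_unique (g : AF) (q : rat) (u : adele) : 0 < q -> zhat_units u ->
  \det (bc_phi g) = adele_rat q * u -> det_phi g = q.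
Proof.
have dvd (q1 q2 : rat) (u1 u2 : adele) : 0 < q1 -> zhat_units u1 -> zhat_units u2 ->
    adele_rat q1 * u1 = adele_rat q2 * u2 -> exists z : int, q1 = z%:~R * q2.
  move=> q10 [/zhatP u1z [v1 /zhatP v1z uv1]] [/zhatP u2z _] e.
  have [q20|q20] := eqVneq q2 0.
    have : adele_rat q1 * (u1 * v1) = 0.
      by rewrite mulrA e q20 rmorph0 !mul0r.
    rewrite uv1 mulr1 => q1z.
    have : adele_rat (q1^-1 * q1) = 0 by rewrite rmorphM /= q1z mulr0.
    by rewrite mulVf ?gt_eqF // rmorph1 => /eqP; rewrite oner_eq0.
  have /intrP[z zE] : q1 / q2 \is a Num.int.
    apply: zhat_rat; rewrite (_ : adele_rat _ = u2 * v1) ?rpredM //.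
    transitivity (adele_rat q1 * u1 * (adele_rat q2^-1 * v1)).
      by rewrite rmorphM mulrACA uv1 mulr1.
    by rewrite e mulrACA -rmorphM mulfV // rmorph1 mul1r.
  by exists z; rewrite -zE divfK.
move=> q0 uz uE; apply: xget_unique; first by split=> //; exists u.
move=> q' [q'0 [u' uz' uE']].
have [a aE] := dvd _ _ _ _ q'0 uz' uz (etrans (esym uE') uE).
have [b bE] := dvd _ _ _ _ q0 uz uz' (etrans (esym uE) uE').
have a0 : 0 < a by rewrite -(ltr0z rat) -(pmulr_lgt0 _ q0) -aE.
have b0 : 0 < b by rewrite -(ltr0z rat) -(pmulr_lgt0 _ q'0) -bE.
have ab : a * b = 1.
  apply/eqP; rewrite -(eqr_int rat) intrM; apply/eqP/(mulIf (lt0r_neq0 q'0)).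
  by rewrite -mulrA -bE -aE mul1r.
suff -> : q' = q by [].
rewrite aE; suff -> : a = 1 by rewrite mul1r.
case: a a0 ab {aE} => // a a0; case: b b0 {bE} => // b b0 /eqP.
by rewrite -PoszM eqz_nat muln_eq1 => /andP[/eqP ->].
Qed.

Lemma det_phi_norm (g : AF) : sym_f F g -> det_phi g = (ideal_norm (ideal_of g))%:R.
Proof.
move=> sg; have nzI := ideal_of_nonzero sg; have [B B0 BE] := ideal_lattice nzI.
rewrite (ideal_norm_det nzI B0 BE); have gP := ideal_of_hat sg B0 BE.
set A := amult_mx g; pose B' := (map_mx intr B)^a : 'M[adele]_n.
have /fin_all_exists[v vP] (i : 'I_n) : exists v : 'rV[adele]_n,
    (forall j, v 0 j \in zhatp) /\ row i A = v *m B'.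
  have eO : Ohat F (of_acoord (delta_mx 0 i)).
    by apply/OhatP => j; rewrite of_acoordK mxE rpred_nat.
  have /gP[c cz cE] : exists2 h, Ohat F h & of_acoord (delta_mx 0 i) * g = g * h.
    by exists (of_acoord (delta_mx 0 i)); rewrite // mulrC.
  by exists c; split=> //; rewrite -cE acoordM of_acoordK rowE.
have /fin_all_exists[u uP] (i : 'I_n) : exists u : 'rV[adele]_n,
    (forall j, u 0 j \in zhatp) /\ row i B' = u *m A.
  have [h hO hE] : exists2 h, Ohat F h & of_acoord (row i B') = g * h.
    apply/gP; exists (delta_mx 0 i); last by rewrite of_acoordK -rowE.
    by move=> j; rewrite mxE rpred_nat.
  exists (acoord h); split; first exact/OhatP.
  by rewrite -acoordM mulrC -hE of_acoordK.
pose U := \matrix_i u i; pose V := \matrix_i v i.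
have AE : A = V *m B' by apply/row_matrixP => i; rewrite [RHS]row_mul rowK (vP i).2.
have BE' : B' = U *m A by apply/row_matrixP => i; rewrite [RHS]row_mul rowK (uP i).2.
have detB' : \det B' = adele_rat (\det B)%:~R by rewrite !det_map_mx.
have UV : \det V * \det U = 1.
  have : \det U * \det V * \det B' = \det B' by rewrite -mulrA -!det_mulmx -AE -BE'.
  have inv : adele_rat (\det B)%:~R * adele_rat (\det B)%:~R^-1 = 1.
    by rewrite -rmorphM mulfV ?intr_eq0 // rmorph1.
  by rewrite detB' => UVB; rewrite mulrC -[LHS]mulr1 -inv mulrA UVB.
have Uz : \det U \in zhatp by apply: det_closed => i j; rewrite mxE; case: (uP i).
have Vz : \det V \in zhatp by apply: det_closed => i j; rewrite mxE; case: (vP i).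
(* s is the sign of det B *)
pose s : adele := (-1) ^+ (\det B < 0)%R.
have sz : s \in zhatp by rewrite rpredX ?rpredN ?rpred1.
apply: (@det_phi_unique _ _ (s * \det V)).
- by rewrite ltr0n absz_gt0.
- split; first by apply/zhatP; rewrite rpredM.
  exists (s * \det U); first by apply/zhatP; rewrite rpredM.
  by rewrite mulrACA UV mulr1 /s -expr2 sqrr_sign.
rewrite /bc_phi -det_amult_mx -/A AE det_mulmx detB' {1}[\det B]intEsign.
by rewrite intrM !rmorphM rmorph_sign /= rmorph_sign mulrC -mulrA mulrCA.
Qed.

(** * Ideals are locally principal *)

Lemma ideal_of_surj (I : set F) : nonzero_ideals F I ->
  exists2 g, sym_f F g & ideal_of g = I.
Proof.
move=> nzI; have [D D1 ID] := ideal_nat nzI.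
have [g0 [Ig0 g00 [k kD g0P]]] := ideal_local_generator nzI D1.
(* g is g0 at the primes dividing D and 1 at the other primes *)
pose e := adele_at D; pose g : AF := pure_tensor g0 e + pure_tensor 1 (1 - e).
have ee : e * (1 - e) = 0 by rewrite mulrBr mulr1 adele_at_idem subrr.
have ez : e \in zhatp := adele_at_zhat D.
have ez' : 1 - e \in zhatp by rewrite rpredB ?rpred1.
have e'e' : (1 - e) * (1 - e) = 1 - e by rewrite mulrBl ee subr0 mul1r.
have k0 : k%:R != 0 :> rat.
  rewrite pnatr_eq0; apply: contraTneq kD => ->.
  by rewrite /coprime gcd0n; case: (D) D1 => [|[]].
have D0 : D%:R != 0 :> rat by rewrite pnatr_eq0 -lt0n ltnW.
have gM x y : g * (pure_tensor x e + pure_tensor y (1 - e)) =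
    pure_tensor (g0 * x) e + pure_tensor y (1 - e).
  rewrite mulrDl !mulrDr ![_ * _ : AF]adeleF_mul_pure (mulrC (1 - e) e) ee adele_at_idem.
  by rewrite e'e' !mul1r /pure_tensor !scale0r addr0 add0r.
have split1 x : emb x = pure_tensor x e + pure_tensor x (1 - e).
  by rewrite /pure_tensor -scalerDl addrC subrK.
have gO : Ohat F g.
  have g0O : g0 \in intp by exact: ideal_sub Ig0.
  have oO : 1 \in intp by exact: rpred1.
  by apply: OhatD; rewrite pure_emb; apply: OhatZ => //; apply/Ohat_emb.
have sg : sym_f F g.
  apply/sym_fP; split=> //; apply/unitrP.
  exists (pure_tensor g0^-1 e + pure_tensor 1 (1 - e)).
  by rewrite mulrC gM mulfV // -split1.
have pureZ (r : rat) (x : F) (a : adele) :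
    pure_tensor (r *: x) a = pure_tensor x (adele_rat r * a).
  by rewrite /pure_tensor linearZ map_mxZ scalerA mulrC.
exists g => //; apply/seteqP; split=> x; last first.
  move=> Ix; have [u uO uE] := g0P x Ix.
  exists (pure_tensor (x / g0) e + pure_tensor x (1 - e)); last first.
    by rewrite gM mulrCA mulfV // mulr1 split1.
  apply: OhatD; last first.
    by rewrite pure_emb; apply: OhatZ => //; apply/Ohat_emb; exact: ideal_sub Ix.
  (* k is invertible where e is supported *)
  have -> : x / g0 = k%:R^-1 *: u.
    apply: (scalerI k0); rewrite scalerA mulfV // scale1r scaler_nat -mulr_natl.
    by rewrite mulrA uE mulrAC mulfV // mul1r.
  rewrite pureZ pure_emb; apply: OhatZ; first exact: adele_at_inv.
  exact/Ohat_emb.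
move=> [h [m [y [a [yO az ->]]]] xE].
have [B B0 BE] := ideal_lattice nzI.
pose hatI (l : AF) := exists2 c : 'rV[adele]_n, (forall j, c 0 j \in zhatp) &
  acoord l = c *m (map_mx intr B)^a.
have hatD l l' : hatI l -> hatI l' -> hatI (l + l').
  move=> [c cz lE] [c' cz' lE']; exists (c + c'); first by move=> j; rewrite mxE rpredD.
  by rewrite acoordD lE lE' mulmxDl.
have hat_pure z b : I z -> b \in zhatp -> hatI (pure_tensor z b).
  move=> /BE[v vE] bz; exists (b *: (map_mx intr v)^a).
    by move=> j; rewrite !mxE rpredM // zhat_intr.
  by rewrite pure_emb acoordZ acoord_emb vE !map_mxM scalemxAl.
have hat0 : hatI 0.
  exists 0; first by move=> j; rewrite mxE rpred0.
  by rewrite mul0mx [LHS]mul0mx.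
suff [c cz cE] : hatI (emb x) by apply/BE; exact: lattice_emb B0 cz cE.
rewrite xE mulr_sumr; elim/big_ind: _ => // i _.
rewrite mulrDl ![_ * _ : AF]adeleF_mul_pure mul1r; have /intpP yiO := yO i.
have /zhatP azi := az i.
apply: hatD; first by apply: hat_pure; [rewrite mulrC; exact: idealM | exact: rpredM].
(* D lies in I and is invertible where 1 - e is supported *)
have -> : y i = D%:R^-1 *: (D%:R * y i).
  by rewrite mulr_natl -scaler_nat scalerA mulVf // scale1r.
rewrite pureZ mulrA; apply: hat_pure; first by rewrite mulrC; exact: idealM.
by apply: rpredM => //; apply: adele_away_inv; exact: ltnW.
Qed.

End IntegralCoordinates.

(** * Equality of the zeta functions *)

(** The chosen representative of the orbit of g has the same ideal as g. *)
Lemma ideal_of_orbit (F : fieldExtType rat) (c : set (adeleF F)) (g : adeleF F) :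
    sym_f F g -> c = [set u * g | u in sym_f_units F] ->
  sym_f F (xget 0 c) /\ ideal_of (xget 0 c) = ideal_of g.
Proof.
have [W uW intW] := integral_basis F.
move=> sg cE; have cx : c (xget 0 c).
  apply: (@xgetI _ _ c g); rewrite cE; exists 1; last by rewrite mul1r.
  apply/sym_f_unitsP; split; first exact: Ohat1 uW intW.
  by exists 1; [exact: Ohat1 uW intW | rewrite mulr1].
have [u uu <-] : [set u * g | u in sym_f_units F] (xget 0 c) by rewrite -cE.
split; last exact: ideal_of_unit uW intW _ _ uu.
have [[/sym_fP[uO ui] _] /sym_fP[gO gi]] := (uu, sg).
by apply/sym_fP; split; [exact: OhatM uW intW _ _ uO gO | rewrite unitrM ui].
Qed.

Theorem lemma7p3p2 (R : realType) (F : fieldExtType rat) :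
  sym_f F = Ohat F `&` [set g : adeleF F | g \is a GRing.unit] /\
  forall s : R[i],
    (zeta_bc_converges F s <-> dedekind_converges F s) /\
    zeta_bc F s = dedekind_zeta F s.
Proof.
split; first exact: sym_fE.
move=> s; suff E : partial_sum (zeta_bc_term F s \_ (sym_f_orbits F)) @ totally =
    partial_sum (dedekind_term F s \_ (nonzero_ideals F)) @ totally.
  by rewrite /zeta_bc_converges /dedekind_converges /zeta_bc /dedekind_zeta /sum E.
have [W uW intW] := integral_basis F.
pose orbit (g : adeleF F) := [set u * g | u in sym_f_units F].
pose G I := [set g : adeleF F | sym_f F g /\ ideal_of g = I].
pose gen I := xget 0 (G I).
have genP I : nonzero_ideals F I -> sym_f F (gen I) /\ ideal_of (gen I) = I.
  move=> /(ideal_of_surj uW intW)[g sg gI].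
  by apply: (@xgetI _ 0 (G I) g).
have orbit_unit (u g : adeleF F) : sym_f_units F u -> orbit (u * g) = orbit g.
  move=> [su [v sv uv]].
  have mulS (a b : adeleF F) : sym_f F a -> sym_f F b -> sym_f F (a * b).
    move=> /sym_fP[aO ua] /sym_fP[bO ub]; apply/sym_fP.
    by split; [exact: OhatM uW intW _ _ aO bO | rewrite unitrM ua].
  apply/seteqP; split=> _ [w [sw [w' sw' ww']] <-].
    exists (w * u); last by rewrite mulrA.
    split; first exact: mulS.
    by exists (w' * v); [exact: mulS | rewrite mulrACA ww' uv mulr1].
  exists (w * v); last by rewrite mulrA -(mulrA w) (mulrC v) uv mulr1.
  split; first exact: mulS.
  by exists (w' * u); [exact: mulS | rewrite mulrACA ww' (mulrC v) uv mulr1].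
(* the default value outside the support of a family is point, which is 0 in
   R[i] *)
apply: (@partial_sum_reindex _ _ _ R[i]^o _ _ _ _ (fun c => ideal_of (xget 0 c))
  (fun I => orbit (gen I))).
- move=> _ [g sg <-]; have [sg' _] := ideal_of_orbit sg erefl.
  exact: ideal_of_nonzero uW intW _ sg'.
- by move=> I /genP[sg _]; exists (gen I).
- move=> _ [g sg <-]; have [sg' gE] := ideal_of_orbit sg erefl.
  rewrite gE; have [sI EI] := genP _ (ideal_of_nonzero uW intW sg).
  have [u uu uE] := ideal_of_inj uW intW sg sI (esym EI).
  by rewrite uE; exact: orbit_unit.
- move=> I /genP[sg gE].
  by rewrite (ideal_of_orbit sg erefl).2.
- move=> _ [g sg <-]; have [sg' _] := ideal_of_orbit sg erefl.
  by rewrite /zeta_bc_term /dedekind_term (det_phi_norm uW intW sg') ratr_nat.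
Qed.
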